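(* Let $d\ge 2$ and let $(\mathbf{X}_i)_{i\in\mathbb{Z}}$ be a strictly stationary sequence of $\mathbb{R}^d$-valued random vectors whose common distribution function $F$ has continuous marginal distribution functions $F_1,\dots,F_d$ and copula $C$. Suppose that: (1) the empirical process $\alpha_n=\sqrt{n}(G_n-C)$ converges weakly in $\ell^\infty([0,1]^d)$ to a tight, centered Gaussian field $\mathbb{B}_C$ concentrated on $\mathbb{D}_0$; (2) for each $p=1,\dots,d$ the partial derivative $\partial_pC(\mathbf{u})$ exists and is continuous on $\{\mathbf{u}\in[0,1]^d : u_p\in(0,1)\}$. Then the empirical copula process $\mathbb{C}_n=\sqrt{n}(C_n-C)$ converges weakly in $\ell^\infty([0,1]^d)$ to a Gaussian field $\mathbb{G}_C$, which may be expressed as $$\mathbb{G}_C(\mathbf{u})=\mathbb{B}_C(\mathbf{u})-\sum_{p=1}^d \partial_pC(\mathbf{u})\,\mathbb{B}_C(\mathbf{u}^{(p)}),\qquad \mathbf{u}\in[0,1]^d .$$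
   Context: Notation. $\ell^\infty([0,1]^d)$ is the space of bounded real functions on $[0,1]^d$ with the supremum norm; weak convergence is in the Hoffmann-J\o rgensen sense. $C([0,1]^d)$ denotes the continuous real functions on $[0,1]^d$. Inequalities between vectors are componentwise and $\mathbb{I}$ denotes an indicator. Copula. $C$ is the unique distribution function on $[0,1]^d$ with standard uniform univariate marginals such that $F(\mathbf{x})=C(F_1(x_1),\dots,F_d(x_d))$ for all $\mathbf{x}\in\mathbb{R}^d$. Write $\mathbf{X}_i=(X_{i1},\dots,X_{id})$, $U_{ip}=F_p(X_{ip})$, $\mathbf{U}_i=(U_{i1},\dots,U_{id})$, and $$F_n(\mathbf{x})=\frac1n\sum_{i=1}^n\mathbb{I}\{\mathbf{X}_i\le\mathbf{x}\},\qquad G_n(\mathbf{u})=\frac1n\sum_{i=1}^n\mathbb{I}\{\mathbf{U}_i\le\mathbf{u}\}.$$ For a distribution function $H$ on $\mathbb{R}$, its generalized inverse is $H^-(q)=\inf\{x\in\mathbb{R}: H(x)\ge q\}$ for $0<q\le1$ and $H^-(0)=\sup\{x\in\mathbb{R}: H(x)=0\}$. With $F_{np}$ the $p$-th marginal empirical distribution function of $F_n$, set $F_n^-(\mathbf{u})=(F_{n1}^-(u_1),\dots,F_{nd}^-(u_d))$. The empirical copula is $C_n(\mathbf{u})=F_n(F_n^-(\mathbf{u}))$, $\mathbf{u}\in[0,1]^d$. $\mathbb{D}_0=\{\alpha\in C([0,1]^d): \alpha(1,\dots,1)=0$ and $\alpha(\mathbf{x})=0$ if some of the components of $\mathbf{x}$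 are equal to $0\}$. The function $\partial_pC$ is defined as $0$ on $\{\mathbf{u}\in[0,1]^d: u_p\in\{0,1\}\}$. The vector $\mathbf{u}^{(p)}=(1,\dots,1,u_p,1,\dots,1)$ is obtained from $\mathbf{u}$ by replacing all entries except the $p$-th by $1$. *)

(* Defs.v *)
From HB Require Import structures.
From mathcomp Require Import all_boot all_order all_algebra.
From mathcomp Require Import all_classical all_reals all_analysis measurable_realfun.

Set Implicit Arguments.
Unset Strict Implicit.
Unset Printing Implicit Defensive.

Import Order.TTheory GRing.Theory Num.Theory.
Import numFieldNormedType.Exports.

Local Open Scope classical_set_scope.
Local Open Scope ring_scope.

(* [l^oo(A)] with weak convergence in the sense of Hoffmann-Jorgensen.
   Real functions on [A : set U] are represented by total functions [U -> R],
   in the type [{uniform` A -> R}] whose topology is that of uniform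
   convergence on [A].  Functions that agree on [A] are topologically
   indistinguishable, so open sets, closed sets and continuous real functions
   on this space only depend on restrictions to [A].  On [linf A] the topology
   is the one given by the supremum norm over [A]. *)
Definition linf (R : realType) (U : choiceType) (A : set U) :
    set {uniform` A -> R} :=
  [set f | exists M : R, forall u, A u -> `|f u| <= M].
Arguments linf {R U} A.

(* E^* Y = inf { E V : V measurable, V >= Y, E V exists }, where V may take
   infinite values and E V exists when V^+ or V^- has finite integral. *)
Definition outer_expectation (R : realType) (d : measure_display)
    (T : measurableType d) (P : probability T R) (Y : T -> R) : \bar R :=
  ereal_inf [set e | exists V : T -> \bar R,
    [/\ measurable_fun setT V,
        forall w, ((Y w)%:E <= V w)%E,
        (\int[P]_w (V ^\+ w)%E < +oo)%E \/ (\int[P]_w (V ^\- w)%E < +oo)%E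
      & e = (\int[P]_w V w)%E]].

Section linf_valued.
Context (R : realType) (U : choiceType) (A : set U).

(* Sets open in the subspace [linf A] are the traces of the sets open in
   [{uniform` A -> R}], so the preimages below are those of the open sets that
   generate the Borel sigma-algebra of [linf A]. *)
Definition borel_map (d : measure_display) (T : measurableType d)
    (W : T -> U -> R) : Prop :=
  (forall w, linf A (W w)) /\
  (forall O : set {uniform` A -> R}, open O -> measurable (W @^-1` O)).

(* The [Z n] are arbitrary maps into [linf A]; only the limit is required to
   be Borel measurable. *)
Definition weak_cvg (d : measure_display) (T : measurableType d)
    (P : probability T R) (Z : nat -> T -> U -> R)
    (d' : measure_display) (T' : measurableType d')
    (P' : probability T' R) (W : T' -> U -> R) : Prop :=
  [/\ forall n w, linf A (Z n w),
      borel_map W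
    & forall f : {uniform` A -> R} -> R,
        {within linf A, continuous f} ->
        (exists M : R, forall g, linf A g -> `|f g| <= M) ->
        outer_expectation P (fun w => f (Z n w)) @[n --> \oo] -->
          (\int[P']_w (f (W w))%:E)%E].

(* Closedness of the compact set makes [W @^-1` K] measurable; it is no
   restriction, since [l^oo(A)] itself is a Hausdorff space. *)
Definition tight (d : measure_display) (T : measurableType d)
    (P : probability T R) (W : T -> U -> R) : Prop :=
  forall e : R, 0 < e -> exists K : set {uniform` A -> R},
    [/\ compact K, closed K, K `<=` linf A
      & ((1 - e)%:E <= P (W @^-1` K))%E].

(* [normal_prob m 0] is not the Dirac mass at [m], so the degenerate normal
   law is treated separately. *)
Definition normal_law (m s : R) : set R -> \bar R :=
  if s == 0 then \d_m else normal_prob m s.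

(* All finite-dimensional marginals are (possibly degenerate) multivariate
   normal: every linear combination of coordinates is univariate normal. *)
Definition gaussian_field (d : measure_display) (T : measurableType d)
    (P : probability T R) (W : T -> U -> R) : Prop :=
  forall (k : nat) (t : 'I_k -> U) (a : 'I_k -> R),
    (forall j, A (t j)) ->
    measurable_fun setT (fun w => \sum_(j < k) a j * W w (t j)) /\
    exists m s : R, forall E : set R, measurable E ->
      pushforward P (fun w => \sum_(j < k) a j * W w (t j)) E = normal_law m s E.

Definition centered (d : measure_display) (T : measurableType d)
    (P : probability T R) (W : T -> U -> R) : Prop :=
  forall u, A u -> ('E_P[fun w => W w u] = 0)%E.

End linf_valued.

Section copula.
Context (R : realType) (d : nat).
Implicit Types (u x : 'rV[R]_d) (p : 'I_d).

Definition cube : set 'rV[R]_d := [set u | forall p, 0 <= u 0 p <= 1].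

Context (dO : measure_display) (Omega : measurableType dO)
  (P : probability Omega R).

Definition df (Y : {RV P >-> d.-tuple R}) x : R :=
  fine (P [set w | forall p, tnth (Y w) p <= x 0 p]).

Definition marginal_df (Y : {RV P >-> d.-tuple R}) p (t : R) : R :=
  fine (P [set w | tnth (Y w) p <= t]).

(* [C] is on the cube the distribution function of a probability measure with
   standard uniform marginals; its values off the cube are irrelevant. *)
Definition is_copula (C : 'rV[R]_d -> R) : Prop :=
  exists mu : probability (d.-tuple R) R,
    (forall p (t : R), 0 <= t <= 1 -> mu [set y | tnth y p <= t] = t%:E) /\
    (forall u, cube u -> C u = fine (mu [set y | forall p, tnth y p <= u 0 p])).

Definition copula_of (C : 'rV[R]_d -> R) (Y : {RV P >-> d.-tuple R}) : Prop :=
  is_copula C /\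
  forall x, df Y x = C (\row_p marginal_df Y p (x 0 p)).

End copula.

(* Equality of the joint laws of (X_{t_1}, ..., X_{t_k}) and
   (X_{t_1+h}, ..., X_{t_k+h}) on the product sigma-algebra. *)
Definition strictly_stationary (R : realType) (d : nat)
    (dO : measure_display) (Omega : measurableType dO)
    (P : probability Omega R) (X : int -> {RV P >-> d.-tuple R}) : Prop :=
  forall (k : nat) (t : 'I_k -> int) (h : int)
    (E : set (k.-tuple (d.-tuple R))), measurable E ->
    P [set w | E [tuple X (t j) w | j < k]] =
    P [set w | E [tuple X (t j + h) w | j < k]].

Section empirical.
Context (R : realType) (d : nat).
Implicit Types (u x : 'rV[R]_d) (p : 'I_d).

Definition edf (Y : int -> 'rV[R]_d) (n : nat) x : R :=
  n%:R^-1 * \sum_(1 <= i < n.+1) [forall p, (Y i%:Z 0 p <= x 0 p)%R]%:R.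

Definition marginal_edf (Y : int -> 'rV[R]_d) (n : nat) p (t : R) : R :=
  n%:R^-1 * \sum_(1 <= i < n.+1) (Y i%:Z 0 p <= t)%R%:R.

Definition geninv (H : R -> R) (q : R) : R :=
  if q == 0 then sup [set x | H x = 0] else inf [set x | q <= H x].

Definition empirical_copula (Y : int -> 'rV[R]_d) (n : nat) u : R :=
  edf Y n (\row_p geninv (marginal_edf Y n p) (u 0 p)).

Context (dO : measure_display) (Omega : measurableType dO)
  (P : probability Omega R) (X : int -> {RV P >-> d.-tuple R}).

Definition obs (w : Omega) (i : int) : 'rV[R]_d := \row_p tnth (X i w) p.

Definition uniformized_obs (w : Omega) (i : int) : 'rV[R]_d :=
  \row_p marginal_df (X 0) p (tnth (X i w) p).

Definition empirical_process (C : 'rV[R]_d -> R) (n : nat) (w : Omega) u : R :=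
  Num.sqrt n%:R * (edf (uniformized_obs w) n u - C u).

Definition empirical_copula_process (C : 'rV[R]_d -> R) (n : nat)
    (w : Omega) u : R :=
  Num.sqrt n%:R * (empirical_copula (obs w) n u - C u).

End empirical.

Section limit.
Context (R : realType) (d : nat).
Implicit Types (u x : 'rV[R]_d) (p : 'I_d).

Definition D0 : set ('rV[R]_d -> R) := [set a |
  [/\ {within @cube R d, continuous a}, a (const_mx 1) = 0
    & forall x, cube x -> (exists p, x 0 p = 0) -> a x = 0]].

Definition unit_vec p : 'rV[R]_d := delta_mx 0 p.

(* At points of the cube with 0 < u_p < 1 the directional derivative only
   involves values of [C] on the cube. *)
Definition partial (C : 'rV[R]_d -> R) p u : R :=
  if 0 < u 0 p < 1 then 'D_(unit_vec p) C u else 0.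

Definition proj_ones u p : 'rV[R]_d := \row_q (if q == p then u 0 p else 1).

Definition limit_field (T : Type) (C : 'rV[R]_d -> R)
    (B : T -> 'rV[R]_d -> R) (w : T) u : R :=
  B w u - \sum_(p < d) partial C p u * B w (proj_ones u p).

End limit.

(* Main.v *)
Require Import Defs.
From HB Require Import structures.
From mathcomp Require Import all_boot all_order all_algebra.
From mathcomp Require Import all_classical all_reals all_analysis measurable_realfun.
From mathcomp Require Import ring lra.

Set Implicit Arguments.
Unset Strict Implicit.
Unset Printing Implicit Defensive.

Import Order.TTheory GRing.Theory Num.Theory.
Import numFieldNormedType.Exports.

Local Open Scope classical_set_scope.
Local Open Scope ring_scope.

(** Functional delta method for the map sending a distribution function to its
    copula, carried out path by path.

    Let V be the sample with coordinates F_p(X_ip), G_n its empirical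
    distribution function, s = sqrt n, and suppose that s (G_n - C) is
    uniformly close to a path b of [D0].  Put v_p = F_p(F_np^-(u_p)).  Since the
    F_p are monotone and continuous, the p-th marginal of G_n is at most u_p to
    the left of v_p and at least u_p to its right; letting the argument tend to
    v_p, the continuity of b turns this into s (v_p - u_p) = - b_p(v_p) up to
    the distance from s (G_n - C) to b, where b_p(t) = b(1,..,t,..,1)
    ([quantile_close]).  A similar one-sided limit gives
    s (F_n(F_n^-(u)) - C(v)) = b(v) ([joint_edf_close]).  Ties in the sample do
    not matter: they can only make G_n jump, and the closeness to a continuous
    path already bounds the jumps.  What is left is s (C(v) - C(u)),
    linearized one coordinate at a time ([copula_expansion]): where u_p stays
    away from 0 and 1 by the mean value theorem and the uniform continuity of
    the p-th partial derivative; near 0 and 1, where that derivative may be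
    discontinuous, because b_p is small and C is 1-Lipschitz.  Altogether
    s (C_n - C) is close to [limit_map C b] ([empirical_copula_delta]).

    [extended_continuous_mapping] transfers this to weak convergence.  Tightness
    gives a compact K inside [D0] that carries almost all the mass of the limit,
    and near K the pathwise approximation is uniform.  With a continuous h that
    is 0 on K and 1 away from it, a bounded continuous f of the empirical copula
    process is squeezed between f (limit_map alpha_n) - e - 2 M h(alpha_n) and
    f (limit_map alpha_n) + e + 2 M h(alpha_n), two bounded continuous functions
    of alpha_n.  So the assumed convergence applies, and the outer
    expectation, which is not additive, only has to be monotone.

    The limit is Gaussian because a finite linear combination of its values is
    one of values of B. *)

(** * Uniform convergence on a set *)

Section uniform_topology.
Context (R : realType) (U : choiceType) (A : set U).

Lemma uniform_nbhsP (f : {uniform` A -> R}) (S : set {uniform` A -> R}) :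
  nbhs f S <->
  exists2 e : R, 0 < e &
    forall h : {uniform` A -> R}, (forall u, A u -> `|f u - h u| < e) -> S h.
Proof.
rewrite uniform_nbhs; split.
- move=> [E [entE ES]]; move: entE; rewrite -entourage_ballE.
  move=> [e /= e0 eE]; exists e => // h fh; apply: ES => u Au.
  by apply: eE; exact: fh.
- move=> [e e0 eS]; exists [set xy : R * R | ball xy.1 e xy.2]; split.
  + exact: entourage_ball (PosNum e0).
  + by move=> h fh; apply: eS => u Au; exact: fh.
Qed.

Lemma lipschitz_uniform_continuous (G : {uniform` A -> R} -> {uniform` A -> R}) :
  (exists2 M : R, 0 < M & forall f g e, 0 < e -> (forall u, A u -> `|f u - g u| < e) ->
     forall u, A u -> `|G f u - G g u| <= M * e) -> continuous G.
Proof.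
move=> [M M0 GM] f S /= /uniform_nbhsP[e e0 eS].
apply/uniform_nbhsP; exists (e / (M * 2)); first by rewrite divr_gt0// mulr_gt0.
move=> h fh; apply: eS => u Au.
apply: (le_lt_trans (GM _ _ _ _ fh u Au)); first by rewrite divr_gt0// mulr_gt0.
rewrite [X in X < _](_ : _ = e / 2); first by rewrite ltr_pdivrMr// ltr_pMr// ltr1n.
by field; rewrite gt_eqF.
Qed.

Lemma within_linf_continuousP (f : {uniform` A -> R} -> R) :
  {within linf A, continuous f} <->
  forall b, linf A b -> forall e, 0 < e -> exists2 r : R, 0 < r &
    forall g, linf A g -> (forall u, A u -> `|b u - g u| < r) ->
      `|f b - f g| < e.
Proof.
rewrite subspace_continuousP; split.
- move=> cf b Ab e e0.
  have /cvgrPdist_lt/(_ e e0) := cf b Ab.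
  rewrite near_withinE => /uniform_nbhsP[r r0 rP]; exists r => // g Ag bg.
  exact: rP.
- move=> cf b Ab; apply/cvgrPdist_lt => e e0.
  have [r r0 rP] := cf b Ab e e0.
  rewrite near_withinE; apply/uniform_nbhsP; exists r => // g bg Ag.
  exact: rP.
Qed.

(** The open sets of the real line pull back under [f] to traces on [linf A] of
    open sets, which is all that is needed since [W] takes its values in
    [linf A]. *)
Lemma borel_map_measurable d (T : measurableType d) (W : T -> U -> R)
    (f : {uniform` A -> R} -> R) :
  borel_map A W -> {within linf A, continuous f} ->
  measurable_fun setT (fun w => f (W w)).
Proof.
move=> [WA Wm] cf.
apply: (measurability _ (RGenOpens.measurableE R)) => _ [_ [a [b ->]] <-].
rewrite setTI; set I := (X in _ @^-1` X).
have [V oV VE] : exists2 V : set {uniform` A ->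
    R}, open V & V `&` linf A = f @^-1` I `&` linf A.
  by apply/open_subspaceP; move/continuousP: cf; apply; exact: interval_open.
suff -> : (fun w => f (W w)) @^-1` I = W @^-1` V by exact: Wm.
apply/seteqP; split => w /= h.
- have : (f @^-1` I `&` linf A) (W w) by split => //; exact: WA.
  by rewrite -VE => -[].
- have : (V `&` linf A) (W w) by split => //; exact: WA.
  by rewrite VE => -[].
Qed.

Lemma borel_map_closed d (T : measurableType d) (W : T -> U -> R)
    (D : set {uniform` A -> R}) :
  borel_map A W -> closed D -> measurable (W @^-1` D).
Proof.
move=> [_ Wm] cD; rewrite -(setCK (W @^-1` D)); apply: measurableC.
rewrite preimage_setC; apply: Wm; exact: closed_openC.
Qed.

(** Urysohn's lemma for [K] and the set of functions at uniform distance at least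
    [e] from [K]: the two are separated by an entourage. *)
Lemma linf_separation (K : set {uniform` A -> R}) (e : R) : 0 < e ->
  exists h : {uniform` A -> R} -> R, [/\ continuous h,
    forall g, 0 <= h g <= 1, forall g, K g -> h g = 0 &
    forall g, (forall b, K b -> ~ (forall u, A u -> `|b u - g u| < e)) ->
      h g = 1].
Proof.
move=> e0.
pose F := [set g : {uniform` A -> R} |
  forall b, K b -> ~ (forall u, A u -> `|b u - g u| < e)].
have /(uniform_separatorP (R:=R))[h [ch h01 h0 h1]] : uniform_separator K F.
  apply: uniform_separatorW.
  exists [set fg : {uniform` A -> R} * {uniform` A -> R} | forall u, A u ->
      `|fg.1 u - fg.2 u| < e].
    rewrite uniform_entourage; exists [set xy : R * R | ball xy.1 e xy.2].
      exact: entourage_ball (PosNum e0).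
    by move=> fg /= fge u Au; exact: fge.
  by apply/seteqP; split => // -[f g] /= [[Kf Fg] fg]; exact: (Fg _ Kf).
exists h; split => //.
- by move=> g; have := h01 (h g); rewrite /= in_itv/=; apply; exists g.
- by move=> g Kg; apply: h0; exists g.
- by move=> g Fg; apply: h1; exists g.
Qed.

End uniform_topology.

(** * Outer expectations and the extended continuous mapping theorem *)

Lemma le_outer_expectation (R : realType) d (T : measurableType d)
    (P : probability T R) (Y Y' : T -> R) :
  (forall w, Y w <= Y' w) ->
  (outer_expectation P Y <= outer_expectation P Y')%E.
Proof.
move=> YY'; apply: ereal_inf_le_tmp => _ [V [mV YV intV ->]].
by exists V; split => // w; apply: le_trans (YV w); rewrite lee_fin.
Qed.

Lemma cvg_EFin_dist (R : realType) (e : nat -> \bar R) (l : R) :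
  (forall r : R, 0 < r -> \forall n \near \oo,
    ((l - r)%:E <= e n)%E /\ (e n <= (l + r)%:E)%E) ->
  e n @[n --> \oo] --> l%:E.
Proof.
move=> el; have fin n r : ((l - r)%:E <= e n)%E /\ (e n <= (l + r)%:E)%E ->
    exists2 x, e n = x%:E & `|l - x| <= r.
  case: (e n) => [x|[_]|[]]; rewrite ?leye_eq ?leeNy_eq//.
  by rewrite !lee_fin => -[lx xl]; exists x => //; rewrite ler_distl; lra.
apply/fine_cvgP; split.
- by apply: filterS (el 1 ltr01) => n /fin[x ->].
- apply/cvgrPdist_le => r r0; apply: filterS (el r r0) => n /fin[x xE].
  by rewrite /= xE.
Qed.

(** Outer expectation is not additive, so the difference of two of them cannot be
    estimated directly; limits are obtained by comparison with sequences whose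
    limits are known. *)
Lemma outer_expectation_squeeze (R : realType) d (T : measurableType d)
    (P : probability T R) (Y : nat -> T -> R) (l : R) :
  (forall r : R, 0 < r -> exists (Y1 Y2 : nat -> T -> R) (l1 l2 : R),
    [/\ \forall n \near \oo, forall w, Y1 n w <= Y n w <= Y2 n w,
        outer_expectation P (Y1 n) @[n --> \oo] --> l1%:E,
        outer_expectation P (Y2 n) @[n --> \oo] --> l2%:E
      & l - r <= l1 /\ l2 <= l + r]) ->
  outer_expectation P (Y n) @[n --> \oo] --> l%:E.
Proof.
move=> Y12; apply: cvg_EFin_dist => r r0; pose q := r / 2.
have q0 : 0 < q by rewrite divr_gt0.
have rE : r = q + q by rewrite /q; lra.
have [Y1 [Y2 [l1 [l2 [nY c1 c2 [la lb]]]]]] := Y12 _ q0.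
have /fine_cvgP[fin1 /cvgrPdist_lt/(_ _ q0) d1] := c1.
have /fine_cvgP[fin2 /cvgrPdist_lt/(_ _ q0) d2] := c2.
near=> n; have Yn : forall w, Y1 n w <= Y n w <= Y2 n w by near: n.
have f1 : outer_expectation P (Y1 n) \is a fin_num by near: n.
have f2 : outer_expectation P (Y2 n) \is a fin_num by near: n.
have e1 : `|l1 - fine (outer_expectation P (Y1 n))| < q by near: n.
have e2 : `|l2 - fine (outer_expectation P (Y2 n))| < q by near: n.
split.
- apply: (@le_trans _ _ (outer_expectation P (Y1 n))).
    by rewrite -(fineK f1) lee_fin; move: e1; rewrite ltr_distl rE; lra.
  by apply: le_outer_expectation => w; have /andP[] := Yn w.
- apply: (@le_trans _ _ (outer_expectation P (Y2 n))).
    by apply: le_outer_expectation => w; have /andP[] := Yn w.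
  by rewrite -(fineK f2) lee_fin; move: e2; rewrite ltr_distl rE; lra.
Unshelve. all: by end_near. Qed.

Section bounded_expectation.
Context (R : realType) d (T : measurableType d) (P : probability T R).

Lemma bounded_integrable (Y : T -> R) (M : R) :
  measurable_fun setT Y -> (forall w, `|Y w| <= M) ->
  P.-integrable setT (EFin \o Y).
Proof.
move=> mY YM; apply: measurable_bounded_integrable => //.
  by rewrite /= probability_setT ltry.
exists M; split; first exact: num_real.
by move=> x Mx w _; apply: le_trans (YM w) (ltW Mx).
Qed.

(** Expectation of the functions that squeeze [f (Z n w)] in
    [extended_continuous_mapping]. *)
Lemma affine_expectation (Y H : T -> R) (M a c : R) :
  measurable_fun setT Y -> measurable_fun setT H ->
  (forall w, `|Y w| <= M) -> (forall w, 0 <= H w <= 1) ->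
  (\int[P]_w (Y w + a + c * H w)%:E =
   (fine (\int[P]_w (Y w)%:E) + a + c * fine (\int[P]_w (H w)%:E))%:E)%E.
Proof.
move=> mY mH YM H01.
have iY := bounded_integrable mY YM.
have iH : P.-integrable setT (EFin \o H).
  by apply: (bounded_integrable (M := 1)) => // w; rewrite ger0_norm;
      have /andP[] := H01 w.
have ia : P.-integrable setT (EFin \o cst a).
  by apply: (bounded_integrable (M := `|a|)).
rewrite (_ : (fun w => _) = (fun w => ((Y w)%:E + (cst a w)%:E) + (c%:E * (H
    w)%:E))%E); last first.
  by apply/funext => w; rewrite /= !EFinD EFinM.
rewrite integralD//; last 2 first.
- exact: integrableD.
- exact: integrableZl.
rewrite integralD// integralZl//.
rewrite -{1}(fineK (integrable_fin_num measurableT iY)) -{1}(fineK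
    (integrable_fin_num measurableT iH)).
rewrite (_ : \int[P]_x (cst a x)%:E = a%:E)%E.
  by rewrite !EFinD EFinM.
rewrite (_ : (fun=> _) = cst a%:E)//.
by rewrite integral_cst//= [X in (_ * X)%E]probability_setT mule1.
Qed.

Lemma small_expectation (H : T -> R) (S : set T) (e : R) :
  measurable_fun setT H -> (forall w, 0 <= H w <= 1) ->
  measurable S -> ((1 - e)%:E <= P S)%E -> (forall w, S w -> H w = 0) ->
  0 <= fine (\int[P]_w (H w)%:E) <= e.
Proof.
move=> mH H01 mS PS H0.
have iH : P.-integrable setT (EFin \o H).
  by apply: (bounded_integrable (M := 1)) => // w; rewrite ger0_norm;
      have /andP[] := H01 w.
have fH := integrable_fin_num measurableT iH.
rewrite -!lee_fin fineK//; apply/andP; split.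
  by apply: integral_ge0 => w _; rewrite lee_fin; have /andP[] := H01 w.
apply: (@le_trans _ _ (\int[P]_w (\1_(~` S) w)%:E)%E).
  apply: ge0_le_integral => //.
  - by move=> w _; rewrite lee_fin; have /andP[] := H01 w.
  - exact/measurable_EFinP.
  - by apply/measurable_EFinP; apply: measurable_indic; exact: measurableC.
  - move=> w _; rewrite lee_fin indicE.
    have [Sw|Sw] := pselect (S w).
      by rewrite H0.
    by rewrite mem_set//=; have /andP[] := H01 w.
rewrite integral_indic ?setIT//; last exact: measurableC.
rewrite [X in (X <= _)%E]probability_setC//.
have PSf : P S \is a fin_num by exact: fin_num_measure.
by move: PS; rewrite -(fineK PSf) -EFinB !lee_fin; lra.
Qed.

End bounded_expectation.

Section extended_mapping.
Context (R : realType) (U U' : choiceType) (A : set U) (A' : set U').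
Variable Phi : {uniform` A -> R} -> {uniform` A' -> R}.
Hypothesis Phi_cont : continuous Phi.
Hypothesis Phi_linf : forall b, linf A b -> linf A' (Phi b).

Lemma within_linf_comp (f : {uniform` A' -> R} -> R) :
  {within linf A', continuous f} -> {within linf A, continuous (f \o Phi)}.
Proof.
move=> /within_linf_continuousP cf; apply/within_linf_continuousP => b Ab e e0.
have [r r0 rP] := cf _ (Phi_linf Ab) e e0.
have : nbhs (Phi b) [set g : {uniform` A' -> R} |
    forall u, A' u -> `|Phi b u - g u| < r].
  by apply/uniform_nbhsP; exists r.
move=> /Phi_cont/uniform_nbhsP[r' r'0 r'P]; exists r' => // g Ag bg.
by apply: rP; [exact: Phi_linf|exact: r'P].
Qed.

Lemma borel_map_comp d (T : measurableType d) (W : T -> U -> R) :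
  borel_map A W -> borel_map A' (fun w => Phi (W w)).
Proof.
move=> [WA Wm]; split=> [w|V oV]; first exact: Phi_linf.
apply: (Wm (Phi @^-1` V)); exact: (open_comp (fun x _ => @Phi_cont x)).
Qed.

(** The pathwise approximation [key] has a radius and a rank that depend on [b];
    compactness makes both uniform over [K]. *)
Lemma uniform_approximation_near_compact (I : Type) (al : nat -> I -> U ->
    R) (Z : nat -> I -> U' -> R)
    (K : set {uniform` A -> R}) (f : {uniform` A' -> R} -> R) (e : R) :
  (forall n w, linf A (al n w)) -> (forall n w, linf A' (Z n w)) ->
  compact K -> K `<=` linf A ->
  (forall b, K b -> forall e : R, 0 < e -> exists2 r : R, 0 < r &
     \forall n \near \oo, forall w,
       (forall u, A u -> `|b u - al n w u| < r) ->
       forall u, A' u -> `|Phi b u - Z n w u| < e) ->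
  {within linf A', continuous f} -> 0 < e ->
  exists2 r : R, 0 < r & \forall n \near \oo, forall b, K b -> forall w,
    (forall u, A u -> `|b u - al n w u| < r) ->
    `|f (Phi (al n w)) - f (Z n w)| < e.
Proof.
move=> alA ZA cK KA key cf e0.
pose Q (k : nat) (b : {uniform` A -> R}) := forall n, (k <= n)%N -> forall w,
  (forall u, A u -> `|b u - al n w u| < k.+1%:R^-1) ->
  `|f (Phi (al n w)) - f (Z n w)| < e.
suff [N _ NQ] : \forall k \near \oo, K `<=` Q k.
  exists N.+1%:R^-1 => //; exists N => // n Nn b Kb w.
  by apply: (NQ N _ b Kb n Nn w); rewrite /=.
apply: ((compact_near_coveringP K).1 cK nat \oo Q) => b Kb.
have e2 : 0 < e / 2 by rewrite divr_gt0.
have Ab := KA _ Kb.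
move/within_linf_continuousP : (cf) => cf'.
have [r1 r10 r1P] := cf' _ (Phi_linf Ab) _ e2.
move/within_linf_continuousP : (within_linf_comp cf) => cfP.
have [r2 r20 r2P] := cfP _ Ab _ e2.
have [r3 r30 [N _ NP]] := key _ Kb _ r10.
pose r := Num.min r2 r3.
have r0 : 0 < r / 2 by rewrite divr_gt0// lt_min r20.
have nb : nbhs b [set b' : {uniform` A -> R} | forall u, A u -> `|b u - b' u| < r / 2].
  by apply/uniform_nbhsP; exists (r / 2).
have nk : \forall k \near \oo, (N <= k)%N /\ k.+1%:R^-1 < r / 2.
  near=> k; split; first by near: k; exact: nbhs_infty_ge.
  by near: k; exact: near_infty_natSinv_lt (PosNum r0).
exists ([set b' : {uniform` A -> R} | forall u, A u -> `|b u - b' u| < r / 2],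
        [set k | (N <= k)%N /\ k.+1%:R^-1 < r / 2]) => //.
move=> [b' k] /= [bb' [Nk kr]] n kn w b'w.
have bw u : A u -> `|b u - al n w u| < r.
  move=> Au; rewrite (_ : _ - _ = (b u - b' u) + (b' u - al n w u)); last by ring.
  apply: le_lt_trans (ler_normD _ _) _.
  by rewrite [ltRHS]splitr; apply: ltrD; [exact: bb'|exact: lt_trans (b'w u Au) kr].
have h1 : `|f (Phi b) - f (Phi (al n w))| < e / 2.
  by apply: r2P => // u Au; apply: lt_le_trans (bw u Au) _; rewrite /r ge_min lexx.
have h2 : `|f (Phi b) - f (Z n w)| < e / 2.
  apply: r1P => // u Au; apply: NP => //=; first exact: leq_trans kn.
  by move=> v Av; apply: lt_le_trans (bw v Av) _; rewrite /r ge_min lexx orbT.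
move: h1 h2; rewrite !ltr_norml => /andP[? ?] /andP[? ?]; apply/andP; split; lra.
Unshelve. all: by end_near. Qed.

(** Continuous mapping theorem in which the functionals applied to [al n] vary
    with [n] and are only approximated by [Phi] near paths of [D].  As in the
    classical proof for maps that are Hadamard differentiable tangentially to
    [D], the approximation is only used near a compact part of [D]. *)
Theorem extended_continuous_mapping
    d (T : measurableType d) (P : probability T R)
    d' (T' : measurableType d') (P' : probability T' R)
    (al : nat -> T -> U -> R) (Z : nat -> T -> U' -> R) (W : T' -> U -> R)
    (D : set {uniform` A -> R}) :
  weak_cvg A P al P' W -> tight A P' W ->
  closed D -> {ae P', forall w, D (W w)} ->
  (forall n w, linf A' (Z n w)) ->
  (forall b, linf A b -> D b -> forall e : R, 0 < e -> exists2 r : R, 0 < r &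
     \forall n \near \oo, forall w,
       (forall u, A u -> `|b u - al n w u| < r) ->
       forall u, A' u -> `|Phi b u - Z n w u| < e) ->
  weak_cvg A' P Z P' (fun w => Phi (W w)).
Proof.
move=> [alA bW alW] tW cD aeD ZA key; split => //.
  exact: borel_map_comp bW.
move=> f cf [M0 M0P].
pose M := `|M0| + 1.
have M_gt0 : 0 < M by rewrite /M; have := normr_ge0 M0; lra.
have fM g : linf A' g -> `|f g| <= M.
  by move=> /M0P; have := ler_norm M0; rewrite /M; lra.
have cfP := within_linf_comp cf.
have mfP := borel_map_measurable bW cfP.
have WA : forall w, linf A (W w) by have [] := bW.
have fWM w : `|f (Phi (W w))| <= M by apply: fM; exact: Phi_linf.
have /fineK <- := integrable_fin_num measurableT (bounded_integrable P' mfP fWM).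
have cmp (r : R) : 0 < r -> exists h : {uniform` A -> R} -> R,
  [/\ continuous h, (forall g, 0 <= h g <= 1),
   \forall n \near \oo, forall w,
     `|f (Phi (al n w)) - f (Z n w)| <= r / 2 + 2 * M * h (al n w) &
   2 * M * fine (\int[P']_w (h (W w))%:E) <= r / 2].
  (* Mass at most [e] outside [K] costs at most [2 * M * e = r / 2]. *)
  move=> r0; pose e := r / (4 * M).
  have e0 : 0 < e by rewrite divr_gt0// mulr_gt0.
  have [K [cK clK KA KP]] := tW _ e0.
  have cKD : compact (K `&` D) by exact: compact_closedI.
  have r2 : 0 < r / 2 by rewrite divr_gt0.
  have [||dl dl0 dlP] := uniform_approximation_near_compact alA ZA cKD _ _ cf r2.
  - by move=> b [/KA].
  - by move=> b [/KA Ab Db]; exact: key.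
  have [h [ch h01 h0 h1]] := linf_separation (K `&` D) dl0.
  exists h; split => //.
    apply: filterS dlP => n nP w.
    have [[b [Kb bw]]|nb] := pselect (exists b, (K `&` D) b /\ forall u, A u ->
        `|b u - al n w u| < dl).
      apply: le_trans (ltW (nP b Kb w bw)) _.
      by rewrite lerDl mulr_ge0//; [rewrite mulr_ge0// ltW|have /andP[] :=
          h01 (al n w)].
    rewrite h1; last by move=> b Kb bw; apply: nb; exists b.
    have /ler_normlP[? ?] := fM _ (Phi_linf (alA n w));
        have /ler_normlP[? ?] := fM _ (ZA n w).
    by rewrite ler_norml; apply/andP; split; lra.
  have mKD : measurable (W @^-1` (K `&` D)).
    by apply: borel_map_closed bW _; exact: closedI.
  have mh : measurable_fun setT (fun w => h (W w)).
    by apply: borel_map_measurable bW _; exact: continuous_subspaceT.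
  have PKD : ((1 - e)%:E <= P' (W @^-1` (K `&` D)))%E.
    apply: le_trans KP _.
    have mK := borel_map_closed bW clK; have mD := borel_map_closed bW cD.
    rewrite (measureDI P' mK mD) preimage_setI.
    rewrite [X in (X + _ <= _)%E](_ : _ = 0%E) ?add0e//.
    apply: measure_negligible; first exact: measurableD.
    by apply: negligibleS aeD => w [].
  have /andP[_] := small_expectation mh (fun w => h01 (W w)) mKD PKD (fun w =>
      h0 (W w)).
  rewrite -(@ler_pM2l _ (2 * M)) ?mulr_gt0// => /le_trans; apply.
  by rewrite /e le_eqVlt; apply/orP; left; apply/eqP; field; rewrite gt_eqF.
have cvg_pert (h : {uniform` A -> R} -> R) a c : continuous h ->
    (forall g, 0 <= h g <= 1) ->
    outer_expectation P (fun w => f (Phi (al n w)) + a + c * h (al n w))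
      @[n --> \oo] -->
    (fine (\int[P']_w (f (Phi (W w)))%:E) + a + c * fine (\int[P']_w (h (W w))%:E))%:E.
  move=> ch h01.
  have chA : {within linf A, continuous h} by exact: continuous_subspaceT.
  have mh := borel_map_measurable bW chA.
  rewrite -(affine_expectation P' a c mfP mh fWM (fun w => h01 (W w))).
  apply: (alW (fun g => f (Phi g) + a + c * h g)).
  - move=> g; apply: cvgD; last by apply: cvgMr; exact: chA.
    by apply: cvgD; [exact: cfP|exact: cvg_cst].
  - exists (M + `|a| + `|c|) => g Ag.
    apply: le_trans (ler_normD _ _) _; apply: lerD.
      apply: le_trans (ler_normD _ _) _; apply: lerD => //.
      by apply: fM; exact: Phi_linf.
    rewrite normrM ler_piMr//; have /andP[h0 h1] := h01 g.
    by rewrite ger0_norm.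
apply: outer_expectation_squeeze => r r0.
have [h [ch h01 nh hr]] := cmp r r0.
exists (fun n w => f (Phi (al n w)) + (- (r / 2)) + (- (2 * M)) * h (al n w)).
exists (fun n w => f (Phi (al n w)) + r / 2 + (2 * M) * h (al n w)).
eexists; eexists; split.
- apply: filterS nh => n hn w; have := hn w; rewrite ler_distl.
  by move=> /andP[? ?]; apply/andP; split; lra.
- exact: cvg_pert.
- exact: cvg_pert.
- by rewrite mulNr; split; lra.
Qed.

End extended_mapping.

(** * Copulas *)

(** Heine-Cantor, with the second point allowed anywhere in [A]: a mean value
    point may fall outside the compact set where the increment starts. *)
Lemma compact_uniform_continuous (R : realType) (V : normedModType R)
    (K A : set V) (f : V -> R) :
  compact K -> K `<=` A -> {within A, continuous f} ->
  forall e : R, 0 < e -> exists2 r : R, 0 < r &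
    forall x y, K x -> A y -> `|x - y| < r -> `|f x - f y| < e.
Proof.
move=> cK KA /subspace_continuousP cf e e0.
pose Q (k : nat) x := A x -> forall y, A y -> `|x - y| < k.+1%:R^-1 -> `|f x - f y| < e.
have e2 : 0 < e / 2 by rewrite divr_gt0.
suff [N _ NQ] : \forall k \near \oo, K `<=` Q k.
  by exists N.+1%:R^-1 => // x y Kx Ay; apply: (NQ N) => //=; exact: KA.
apply: ((compact_near_coveringP K).1 cK _ _ Q) => x Kx.
have /cvgrPdist_lt/(_ _ e2) := cf _ (KA _ Kx).
rewrite near_withinE => /nbhs_normP[t /= t0 tP].
have t2 : 0 < t / 2 by rewrite divr_gt0.
exists ([set x' | `|x - x'| < t / 2], [set k | k.+1%:R^-1 < t / 2]) => /=.
  split; first by apply/nbhs_normP; exists (t / 2).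
  exact: near_infty_natSinv_lt (PosNum t2).
move=> [x' k] /= [xx' kt] Ax' y Ay xy.
have [cx' cy] : `|x - x'| < t /\ `|x - y| < t.
  split; first by apply: lt_trans xx' _; rewrite ltr_pdivrMr// ltr_pMr// ltr1n.
  rewrite (_ : x - y = (x - x') + (x' - y)); last by rewrite addrA subrK.
  by apply: le_lt_trans (ler_normD _ _) _; rewrite [ltRHS]splitr;
      apply: ltrD => //; exact: lt_trans xy kt.
rewrite (_ : f x' - f y = (f x' - f x) + (f x - f y)); last by rewrite addrA subrK.
apply: le_lt_trans (ler_normD _ _) _; rewrite [ltRHS]splitr distrC.
by apply: ltrD; [exact: tP|exact: tP].
Qed.

(** Finite families admit a common radius; used over the coordinates. *)
Lemma ex_common_radius (R : realType) (I : finType) (Q : I -> R -> Prop) :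
  (forall i r r', 0 < r' -> r' <= r -> Q i r -> Q i r') ->
  (forall i, exists2 r, 0 < r & Q i r) -> exists2 r, 0 < r & forall i, Q i r.
Proof.
move=> Qm Qr; have [r rP] := choice (fun i => let: ex_intro2 r a b :=
    Qr i in ex_intro (fun r => 0 < r /\ Q i r) r (conj a b)).
exists (\big[Num.min/1]_i r i).
  by apply/bigmin_gtP; split => // i _; have [] := rP i.
move=> i; have [ri0 Qi] := rP i.
apply: Qm Qi; last exact: bigmin_le_cond.
by apply/bigmin_gtP; split => // j _; have [] := rP j.
Qed.

Section copula_facts.
Context (R : realType) (d : nat).
Implicit Types (u v w x : 'rV[R]_d) (p q : 'I_d) (C : 'rV[R]_d -> R).

Definition set_coord u p (t : R) : 'rV[R]_d := \row_q (if q == p then t else u 0 q).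

Lemma cube_set_coord u p t : cube u -> 0 <= t <= 1 -> cube (set_coord u p t).
Proof. by move=> cu t01 q; rewrite mxE; case: ifP. Qed.

Lemma set_coord_id u p : set_coord u p (u 0 p) = u.
Proof. by apply/rowP => q; rewrite mxE; case: eqP => // ->. Qed.

Lemma set_coord_set_coord u p s t : set_coord (set_coord u p s) p t = set_coord u p t.
Proof. by apply/rowP => q; rewrite !mxE; case: eqP. Qed.

Lemma set_coordE u p t : set_coord u p t 0 p = t.
Proof. by rewrite mxE eqxx. Qed.

Lemma cube_proj_ones u p : cube u -> cube (proj_ones u p).
Proof. by move=> cu q; rewrite mxE; case: ifP => //; rewrite ler01 lexx. Qed.

Lemma compact_box (a b : 'I_d -> R) :
  compact [set u : 'rV[R]_d | forall p, a p <= u 0 p <= b p].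
Proof.
have := @rV_compact R d (fun p => `[a p, b p]%classic).
rewrite (_ : [set _ | _] = [set u : 'rV[R]_d | forall p, a p <= u 0 p <= b p]).
  by apply => p; exact: segment_compact.
by apply/seteqP; split => u /= h p; have := h p; rewrite /= in_itv/=.
Qed.

Lemma rV_norm_lt u (r : R) : 0 < r -> (forall p, `|u 0 p| < r) -> `|u| < r.
Proof.
move=> r0 ur; rewrite /Num.norm/= mx_normrE.
by apply/bigmax_ltP; split => // -[i j] _ /=; rewrite ord1.
Qed.

Variable C : 'rV[R]_d -> R.
Hypothesis copC : is_copula C.

Lemma measurable_le_tnth p (t : R) : measurable [set y : d.-tuple R | tnth y p <= t].
Proof.
rewrite -[X in measurable X]setTI.
apply: measurable_fun_le => //; exact: measurable_tnth.
Qed.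

Lemma measurable_orthant u :
  measurable [set y : d.-tuple R | forall p, tnth y p <= u 0 p].
Proof.
rewrite (_ : [set _ | _] = \bigcap_(p in [set: 'I_d]) [set y : d.-tuple R |
    tnth y p <= u 0 p]).
  by apply: fin_bigcap_measurable => // p _; exact: measurable_le_tnth.
by apply/seteqP; split => y /= h p; [move=> _; exact: h|exact: h].
Qed.

Lemma copula_ge0_le1 u : cube u -> 0 <= C u <= 1.
Proof.
have [mu [_ CE]] := copC => cu; rewrite CE//.
have mS := measurable_orthant u.
rewrite fine_ge0 ?measure_ge0//= -lee_fin fineK ?fin_num_measure//.
exact: probability_le1.
Qed.

Lemma copula_eq0 u p : cube u -> u 0 p = 0 -> C u = 0.
Proof.
have [mu [margin CE]] := copC => cu up; rewrite CE//.
have mS := measurable_orthant u.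
apply/eqP; rewrite eq_le; apply/andP; split; last by rewrite fine_ge0 ?measure_ge0.
rewrite -lee_fin fineK ?fin_num_measure// -(margin p 0 _) ?lexx ?ler01//.
apply: le_measure; rewrite ?inE//; first exact: measurable_le_tnth.
by move=> y /= /(_ p); rewrite up.
Qed.

(** The margins of the underlying measure are supported on [0, 1], so almost
    surely the constraints on the other coordinates hold. *)
Lemma copula_proj_ones u p : cube u -> C (proj_ones u p) = u 0 p.
Proof.
have [mu [margin CE]] := copC => cu; rewrite CE; last exact: cube_proj_ones.
have mS := measurable_orthant (proj_ones u p).
rewrite (_ : mu _ = mu [set y | tnth y p <= u 0 p]); first by rewrite margin.
have mp := measurable_le_tnth p (u 0 p).
rewrite [RHS](measureDI mu mp mS) [X in (_ = X + _)%E](_ : _ = 0%E).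
  rewrite add0e setIC setIidl// => y /= /(_ p); by rewrite mxE eqxx.
apply: measure_negligible; first exact: measurableD.
have : {ae mu, forall y, forall q, tnth y q <= 1}.
  apply: filter_forall => q; exists (~` [set y : d.-tuple R | tnth y q <= 1]);
      split => //.
  - by apply: measurableC; exact: measurable_le_tnth.
  - rewrite [LHS]probability_setC; last exact: measurable_le_tnth.
    by rewrite [X in (_ - X)%E]margin ?ler01 ?lexx// subee.
apply: negligibleS => y /= [yp nS] y1; apply: nS => q; rewrite mxE.
by case: eqP => // ->.
Qed.

(** The box between the two points is contained in the slab where the [p]-th
    coordinate lies in ]s, t], whose mass is [t - s] by uniformity of the
    margin. *)
Lemma copula_incr u p (s t : R) : cube u -> 0 <= s -> s <= t -> t <= 1 ->
  0 <= C (set_coord u p t) - C (set_coord u p s) <= t - s.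
Proof.
have [mu [margin CE]] := copC => cu s0 st t1.
have s01 : 0 <= s <= 1 by rewrite s0 (le_trans st).
have t01 : 0 <= t <= 1 by rewrite (le_trans s0).
have [cs ct] := (cube_set_coord p cu s01, cube_set_coord p cu t01).
pose S v := [set y : d.-tuple R | forall p, tnth y p <= v 0 p].
have mS v : measurable (S v) by exact: measurable_orthant.
pose L a := [set y : d.-tuple R | tnth y p <= a].
have mL a : measurable (L a) by exact: measurable_le_tnth.
have diffE A B : measurable A -> measurable B -> B `<=` A ->
    (fine (mu A) - fine (mu B))%:E = mu (A `\` B).
  move=> mA mB BA; rewrite EFinB !fineK ?fin_num_measure//.
  rewrite measureD//; last by rewrite ltey_eq fin_num_measure.
  by rewrite setIC setIidl.
have SL : S (set_coord u p s) `<=` S (set_coord u p t).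
  move=> y /= ys q; apply: le_trans (ys q) _; rewrite !mxE; case: ifP => //.
have LL : L s `<=` L t by move=> y /= /le_trans; apply.
have CS v : cube v -> C v = fine (mu (S v)) by exact: CE.
rewrite !CS//; apply/andP; split; rewrite -lee_fin diffE//.
have -> : (t - s)%:E = mu (L t `\` L s) by rewrite -diffE// [mu (L t)]margin//
    [mu (L s)]margin.
apply: le_measure; rewrite ?inE; [exact: measurableD|exact: measurableD|].
move=> y /= [yt ys]; split; first by have := yt p; rewrite set_coordE.
move=> yp; apply: ys => q; have := yt q; rewrite !mxE.
by case: eqP => // ->.
Qed.

Lemma copula_set_coord_lipschitz u p (s t : R) : cube u -> 0 <= s <= 1 -> 0 <= t <= 1 ->
  `|C (set_coord u p t) - C (set_coord u p s)| <= `|t - s|.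
Proof.
move=> cu /andP[s0 s1] /andP[t0 t1].
have [st|/ltW ts] := leP s t.
  by have /andP[? ?] := copula_incr p cu s0 st t1; rewrite !ger0_norm// subr_ge0.
by have /andP[? ?] := copula_incr p cu t0 ts s1;
    rewrite distrC [leRHS]distrC !ger0_norm// subr_ge0.
Qed.

(** Points of the path from [u] to [v] that moves one coordinate at a time. *)
Definition hybrid u v (k : nat) : 'rV[R]_d :=
    \row_q (if (q < k)%N then v 0 q else u 0 q).

Lemma hybrid_cube u v k : cube u -> cube v -> cube (hybrid u v k).
Proof. by move=> cu cv q; rewrite mxE; case: ifP. Qed.

Lemma hybrid_step u v p : hybrid u v p.+1 = set_coord (hybrid u v p) p (v 0 p).
Proof.
apply/rowP => q; rewrite !mxE ltnS.
case: (eqVneq q p) => [->|qp]; first by rewrite leqnn.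
by rewrite leq_eqVlt (inj_eq val_inj) (negbTE qp).
Qed.

Lemma copula_telescope u v :
  C v - C u = \sum_(p < d) (C (set_coord (hybrid u v p) p (v 0 p)) - C (hybrid u v p)).
Proof.
under eq_bigr do rewrite -hybrid_step.
rewrite -(big_mkord xpredT (fun k => C (hybrid u v k.+1) - C (hybrid u v k))).
rewrite telescope_sumr//; congr (C _ - C _); apply/rowP => q; rewrite mxE//.
by rewrite ltn_ord.
Qed.

Lemma copula_lipschitz u v : cube u -> cube v ->
  `|C v - C u| <= \sum_(p < d) `|v 0 p - u 0 p|.
Proof.
move=> cu cv; rewrite copula_telescope; apply: le_trans (ler_norm_sum _ _ _) _.
apply: ler_sum => p _.
have ch := hybrid_cube p cu cv.
have hp : hybrid u v p 0 p = u 0 p by rewrite mxE ltnn.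
by rewrite -{2}(set_coord_id (hybrid u v p) p) hp; exact: copula_set_coord_lipschitz.
Qed.

End copula_facts.

(** * First-order expansion of a copula *)

Section copula_increments.
Context (R : realType) (d : nat).
Implicit Types (u v w x : 'rV[R]_d) (p q : 'I_d).
Variable C : 'rV[R]_d -> R.
Hypothesis copC : is_copula C.
Hypothesis C_derivable : forall p u,
  cube u -> 0 < u 0 p < 1 -> derivable C u (unit_vec R p).
Hypothesis partial_continuous : forall p,
  {within [set u | cube u /\ 0 < u 0 p < 1], continuous (partial C p)}.

Lemma shift_unit_vec u p (h : R) : h *: unit_vec R p + u = set_coord u p (h + u 0 p).
Proof.
apply/rowP => q; rewrite !mxE eqxx/=.
by case: eqP => [->|_]; rewrite ?mulr1// mulr0 add0r.
Qed.

(** Difference quotients of a function that is nondecreasing and 1-Lipschitz in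
    each coordinate lie in [0, 1]. *)
Lemma partial_ge0_le1 u p : cube u -> 0 <= partial C p u <= 1.
Proof.
move=> cu; rewrite /partial; case: ifPn => [u01|_]; last by rewrite lexx ler01.
have /andP[u0 u1] := u01.
have dC := C_derivable cu u01.
have quot : \forall h \near (0 : R)^',
    0 <= h^-1 *: ((C \o shift u) (h *: unit_vec R p) - C u) <= 1.
  have m0 : 0 < Num.min (u 0 p) (1 - u 0 p) by rewrite lt_min u0 subr_gt0.
  near=> h.
  have hn0 : h != 0 by near: h; exact: nbhs_dnbhs_neq.
  have : `|h| < Num.min (u 0 p) (1 - u 0 p) by near: h; exact: dnbhs0_lt.
  rewrite lt_min !ltr_norml => /andP[/andP[? ?] /andP[? ?]].
  rewrite /= shift_unit_vec -[X in _ - C X](set_coord_id u p) /GRing.scale/=.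
  have [h0|h0] := ltP 0 h.
    have /andP[? ?] := @copula_incr _ _ _ copC u p (u 0 p) (h + u 0 p) cu
        ltac:(lra) ltac:(lra) ltac:(lra).
    rewrite mulr_ge0 ?invr_ge0 ?(ltW h0)//= mulrC ler_pdivrMr//; lra.
  have {}h0 : h < 0 by rewrite lt_neqAle hn0.
  have /andP[? ?] := @copula_incr _ _ _ copC u p (h + u 0 p) (u 0 p) cu
      ltac:(lra) ltac:(lra) ltac:(lra).
  rewrite mulrC ler_ndivrMr// ler_ndivlMr//; apply/andP; split; lra.
apply/andP; split.
- by apply: limr_ge => //; apply: filterS quot => h /andP[].
- by apply: limr_le => //; apply: filterS quot => h /andP[].
Unshelve. all: by end_near. Qed.

Lemma partial_norm_le1 u p : cube u -> `|partial C p u| <= 1.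
Proof. by move=> cu; have /andP[? ?] := partial_ge0_le1 p cu; rewrite ger0_norm. Qed.

Lemma copula_MVT u p (a b : R) : cube u -> 0 < a -> a <= b -> b < 1 ->
  exists2 c, a <= c <= b &
    C (set_coord u p b) - C (set_coord u p a) = partial C p (set_coord u p c) * (b - a).
Proof.
move=> cu a0 ab b1.
have quotE (x : R) : (fun h : R => h^-1 *: (((fun t => C (set_coord u p t)) \o
    shift x) (h *: (1 : R)) - C (set_coord u p x)))
    = (fun h : R => h^-1 *: ((C \o shift (set_coord u p x)) (h *: unit_vec R p)
        - C (set_coord u p x))).
  apply/funext => h; rewrite /= shift_unit_vec set_coord_set_coord set_coordE.
  by rewrite [h *: 1]mulr1.
have der (x : R) : a <= x <= b ->
    is_derive x 1 (fun t => C (set_coord u p t)) (partial C p (set_coord u p x)).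
  move=> /andP[ax xb].
  have x01 : 0 < x < 1 by apply/andP; split; lra.
  have cx : cube (set_coord u p x) by apply: cube_set_coord => //; apply/andP;
      split; lra.
  have dx : derivable C (set_coord u p x) (unit_vec R p) by apply: C_derivable;
      rewrite ?set_coordE.
  split; first by rewrite /derivable quotE.
  by rewrite /partial set_coordE x01 /derive quotE.
have [|||c cab ->] := @MVT_segment R (fun t => C (set_coord u p t)) (fun t =>
    partial C p (set_coord u p t)) a b.
- exact: ab.
- by move=> x; rewrite in_itv/= => /andP[/ltW ax /ltW xb]; apply: der; rewrite ax.
- apply: derivable_within_continuous => x; rewrite in_itv/= => /der[].
  by [].
by exists c => //; move: cab; rewrite in_itv.
Qed.

Lemma copula_secant u p (a b : R) : cube u -> 0 < a < 1 -> 0 < b < 1 ->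
  exists2 c, `|c - a| <= `|b - a| /\ (Num.min a b <= c <= Num.max a b) &
    C (set_coord u p b) - C (set_coord u p a) = partial C p (set_coord u p c) * (b - a).
Proof.
move=> cu /andP[a0 a1] /andP[b0 b1].
have [ab|/ltW ba] := leP a b.
  have [c /andP[ac cb] E] := copula_MVT p cu a0 ab b1; exists c => //.
  by split; rewrite ?ac// !ger0_norm ?subr_ge0// lerD2r.
have [c /andP[bc ca] E] := copula_MVT p cu b0 ba a1; exists c.
  by split; rewrite ?bc// ![`|_ - a|]distrC !ger0_norm ?subr_ge0// lerD2l lerN2.
by rewrite -opprB E -mulrN opprB.
Qed.

(** Moving one coordinate.  Close to the faces u_p = 0 and u_p = 1 both terms are
    small, since [be] is small there and [C] is 1-Lipschitz; elsewhere the mean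
    value theorem applies on a compact set where the partial derivative is
    uniformly continuous. *)
Lemma increment_expansion p (be : R -> R) (M e : R) : 0 < e -> 0 < M ->
  (forall t, 0 <= t <= 1 -> `|be t| <= M) ->
  (forall e : R, 0 < e -> exists2 k : R, 0 < k &
     forall t, 0 <= t <= 1 -> t < k \/ 1 - k < t -> `|be t| < e) ->
  exists de rho : R, [/\ 0 < de, 0 < rho &
   forall (s : R) u w t, 0 < s -> cube u -> cube w -> 0 <= t <= 1 ->
     w 0 p = u 0 p -> (forall q, `|w 0 q - u 0 q| <= rho) ->
     `|t - u 0 p| <= rho -> `|s * (t - u 0 p) + be (u 0 p)| <= de ->
     `|s * (C (set_coord w p t) - C w) + partial C p u * be (u 0 p)| <= e].
Proof.
move=> e0 M0 beM be0.
have e4 : 0 < e / 4 by rewrite divr_gt0.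
have eM : 0 < e / (4 * M) by rewrite divr_gt0// mulr_gt0.
have [k0 k00 k0P] := be0 _ e4.
(* Capping [k0] at 1/4 leaves room for the strip [k/2, 1 - k/2]. *)
pose k := Num.min k0 (1/4).
have k_gt0 : 0 < k by rewrite lt_min k00; lra.
have kP t : 0 <= t <= 1 -> t < k \/ 1 - k < t -> `|be t| < e / 4.
  have kk : k <= k0 by rewrite ge_min lexx.
  by move=> t01 h; apply: k0P => //; case: h => h; [left|right]; lra.
have k14 : k <= 1 / 4 by rewrite ge_min lexx orbT.
clearbody k.
(* The start [u 0 p] is in [k, 1 - k]; a step of size at most [k / 2] keeps the
   mean value point in ]0, 1[, and [K] contains every [u] to be considered. *)
pose K := [set u : 'rV[R]_d | forall q, (if q == p then k / 2 else 0) <= u 0 q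
    <= (if q == p then 1 - k / 2 else 1)].
have cK : compact K by exact: compact_box.
have KA : K `<=` [set u | cube u /\ 0 < u 0 p < 1].
  move=> u Ku; split.
    move=> q; have := Ku q; case: ifP => // _ /andP[? ?]; apply/andP; split; lra.
  have := Ku p; rewrite eqxx => /andP[? ?]; apply/andP; split; lra.
have [r r0 rP] := compact_uniform_continuous cK KA (@partial_continuous p) eM.
exists (e / 4), (Num.min (k / 2) (r / 2)); split => //.
  by rewrite lt_min !divr_gt0.
move=> s u w t s0 cu cw t01 wp wu tu stu.
have wE : C w = C (set_coord w p (u 0 p)) by rewrite -wp set_coord_id.
have := partial_norm_le1 p cu => P1.
have up01 := cu p.
have [near_bd|inside] := pselect (u 0 p < k \/ 1 - k < u 0 p).
  have bs := kP _ up01 near_bd.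
  have h1 : `|s * (C (set_coord w p t) - C w)| <= e / 2.
    rewrite normrM (gtr0_norm s0) wE.
    apply: le_trans (ler_wpM2l (ltW s0) (copula_set_coord_lipschitz copC p cw
        up01 t01)) _.
    rewrite -[X in X * _](gtr0_norm s0) -normrM.
    rewrite (_ : s * (t - u 0 p) = (s * (t - u 0 p) + be (u 0 p)) - be (u 0
        p)); last by ring.
    by apply: le_trans (ler_normB _ _) _; lra.
  have h2 : `|partial C p u * be (u 0 p)| <= e / 4.
    by rewrite normrM; apply: le_trans (ler_piMl _ P1) (ltW bs).
  by apply: le_trans (ler_normD _ _) _; lra.
have /andP[ku uk] : k <= u 0 p <= 1 - k.
  by rewrite !leNgt; apply/andP; split; apply/negP => h; apply: inside; [left|right].
have tk : `|t - u 0 p| <= k / 2 by apply: le_trans tu _; rewrite ge_min lexx.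
have /andP[tl tr] : k / 2 <= t <= 1 - k / 2.
  by move: tk => /ler_normlP[? ?]; apply/andP; split; lra.
have [||c [cu1 cu2] CE] := copula_secant p cw (_ : 0 < u 0 p < 1) (_ : 0 < t < 1).
- by apply/andP; split; lra.
- by apply/andP; split; lra.
have c01 : 0 <= c <= 1.
  move: cu2; rewrite ge_min le_max => /andP[/orP h1 /orP h2].
  by apply/andP; split; [case: h1|case: h2] => ?; lra.
rewrite wE CE.
set g := partial C p (set_coord w p c).
have gE : `|partial C p u - g| < e / (4 * M).
  apply: rP.
  - move=> q; case: eqP => [->|_]; last exact: cu.
    apply/andP; split; lra.
  - split; first exact: cube_set_coord.
    rewrite set_coordE; move: cu2; rewrite ge_min le_max => /andP[/orP h1 /orP h2].
    by apply/andP; split; [case: h1|case: h2] => ?; lra.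
  - apply: rV_norm_lt => // q; rewrite !mxE.
    have rr : Num.min (k / 2) (r / 2) < r.
      by rewrite gt_min; apply/orP; right; rewrite ltr_pdivrMr// ltr_pMr// ltr1n.
    apply: le_lt_trans rr.
    case: eqP => [->|_]; rewrite distrC//.
    exact: le_trans cu1 tu.
have g1 : `|g| <= 1 by apply: partial_norm_le1; exact: cube_set_coord.
rewrite (_ : _ + _ = g * (s * (t - u 0 p) + be (u 0 p)) + (partial C p u - g) *
    be (u 0 p)); last by ring.
apply: le_trans (ler_normD _ _) _; rewrite !normrM.
have h1 : `|g| * `|s * (t - u 0 p) + be (u 0 p)| <= e / 4.
  by apply: le_trans (ler_piMl _ g1) stu.
have h2 : `|partial C p u - g| * `|be (u 0 p)| <= e / (4 * M) * M.
  apply: ler_pM => //; [exact: ltW|exact: beM].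
have h3 : e / (4 * M) * M = e / 4 by field; rewrite gt_eqF.
rewrite h3 in h2; lra.
Qed.

(** First-order expansion of [C] along directions [v - u] close to [- be / s],
    uniform in [u]: telescoping over hybrid points, each of which is as close to
    [u] as [v] is. *)
Lemma copula_expansion (be : 'I_d -> R -> R) (M e : R) : 0 < e -> 0 < M ->
  (forall p t, 0 <= t <= 1 -> `|be p t| <= M) ->
  (forall p (e : R), 0 < e -> exists2 k : R, 0 < k &
     forall t, 0 <= t <= 1 -> t < k \/ 1 - k < t -> `|be p t| < e) ->
  exists2 r : R, 0 < r &
   forall (s : R) u v, 0 < s -> cube u -> cube v ->
     (forall p, `|v 0 p - u 0 p| <= r) ->
     (forall p, `|s * (v 0 p - u 0 p) + be p (u 0 p)| <= r) ->
     `|s * (C v - C u) + \sum_(p < d) partial C p u * be p (u 0 p)| <= e.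
Proof.
move=> e0 M0 beM be0.
pose e' := e / d.+1%:R.
have e'0 : 0 < e' by rewrite divr_gt0.
pose Q p (r : R) := forall (s : R) u w (t : R), 0 < s -> cube u -> cube w ->
    0 <= t <= 1 ->
     w 0 p = u 0 p -> (forall q, `|w 0 q - u 0 q| <= r) ->
     `|t - u 0 p| <= r -> `|s * (t - u 0 p) + be p (u 0 p)| <= r ->
     `|s * (C (set_coord w p t) - C w) + partial C p u * be p (u 0 p)| <= e'.
have [r r0 rP] : exists2 r, 0 < r & forall p, Q p r.
  apply: ex_common_radius => [p r r' r'0 rr Qr s u w t s0 cu cw t01 wu h1 h2 h3|p].
    apply: Qr => //; first by move=> q; exact: le_trans rr.
    - exact: le_trans rr.
    - exact: le_trans rr.
  have [de [rho [de0 rho0 drP]]] := increment_expansion p e'0 M0 (beM p) (be0 p).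
  exists (Num.min de rho); first by rewrite lt_min de0.
  move=> s u w t s0 cu cw t01 wu h1 h2 h3.
  have [l1 l2] : Num.min de rho <= de /\ Num.min de rho <= rho.
    by rewrite !ge_min !lexx orbT.
  apply: drP => //; first by move=> q; exact: le_trans l2.
  - exact: le_trans l2.
  - exact: le_trans l1.
exists r => // s u v s0 cu cv vu svu.
rewrite (copula_telescope C u v) mulr_sumr -big_split/=.
apply: le_trans (ler_norm_sum _ _ _) _.
apply: (@le_trans _ _ (\sum_(p < d) e')).
  apply: ler_sum => p _; apply: rP => //; first exact: hybrid_cube.
  - by rewrite mxE ltnn.
  - by move=> q; rewrite mxE; case: ifP => // _; rewrite subrr normr0 ltW.
rewrite sumr_const card_ord -mulr_natr /e' mulrAC ler_pdivrMr// ler_pM2l// ler_nat.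
exact: leqnSn.
Qed.

End copula_increments.

(** * Empirical distribution functions and their generalized inverses *)

Section order_statistics.
Context (R : realType) (d : nat).
Implicit Types (u v w x : 'rV[R]_d) (p q : 'I_d).

Lemma edf_le (Y Y' : int -> 'rV[R]_d) (n : nat) x x' :
  (forall i, (forall p, Y i 0 p <= x 0 p) -> forall p, Y' i 0 p <= x' 0 p) ->
  edf Y n x <= edf Y' n x'.
Proof.
move=> YY'; rewrite /edf ler_wpM2l ?invr_ge0//; apply: ler_sum => i _.
rewrite ler_nat; case: forallP => //= Yx.
by rewrite (introT forallP (YY' _ Yx)).
Qed.

Lemma marginal_edf_le (Y Y' : int -> 'rV[R]_d) (n : nat) p p' (t t' : R) :
  (forall i, Y i 0 p <= t -> Y' i 0 p' <= t') ->
  marginal_edf Y n p t <= marginal_edf Y' n p' t'.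
Proof.
move=> YY'; rewrite /marginal_edf ler_wpM2l ?invr_ge0//; apply: ler_sum => i _.
by rewrite ler_nat; case: leP => //= /YY' ->.
Qed.

Lemma edf_ge0 (Y : int -> 'rV[R]_d) (n : nat) x : 0 <= edf Y n x.
Proof. by rewrite mulr_ge0 ?invr_ge0// sumr_ge0. Qed.

Lemma edf_le1 (Y : int -> 'rV[R]_d) (n : nat) x : edf Y n x <= 1.
Proof.
case: n => [|n]; first by rewrite /edf invr0 mul0r.
rewrite /edf mulrC ler_pdivrMr ?ltr0n// mul1r.
apply: (@le_trans _ _ (\sum_(1 <= i < n.+2) 1)).
  by apply: ler_sum => i _; case: forallP.
by rewrite sumr_const_nat subSS subn0.
Qed.

Lemma marginal_edf_ge0 (Y : int -> 'rV[R]_d) (n : nat) p t : 0 <= marginal_edf Y n p t.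
Proof. by rewrite mulr_ge0 ?invr_ge0// sumr_ge0. Qed.

Lemma edf_ones_but (Y : int -> 'rV[R]_d) (n : nat) p t :
  (forall i q, Y i 0 q <= 1) ->
  edf Y n (\row_q (if q == p then t else 1)) = marginal_edf Y n p t.
Proof.
move=> Y1; rewrite /edf /marginal_edf; congr (_ * _); apply: eq_bigr => i _.
congr (nat_of_bool _)%:R; apply/forallP/idP => [/(_ p)|h q]; rewrite mxE ?eqxx//.
by case: eqP => // ->.
Qed.

(** Makes the sets whose infimum and supremum define [geninv] nonempty and
    bounded. *)
Lemma marginal_edf_bounds (Y : int -> 'rV[R]_d) (n : nat) p : (0 < n)%N ->
  exists M : R, marginal_edf Y n p (- M) = 0 /\ marginal_edf Y n p M = 1.
Proof.
move=> n0; pose M := \sum_(1 <= i < n.+1) `|Y i%:Z 0 p| + 1.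
have YM (i : nat) : (1 <= i < n.+1)%N -> `|Y i%:Z 0 p| < M.
  move=> iI; rewrite /M; apply: (@le_lt_trans _ _ (\sum_(1 <= i < n.+1) `|Y i%:Z 0 p|)).
    rewrite (bigD1_seq i) ?mem_index_iota ?iota_uniq//=.
    by rewrite lerDl sumr_ge0.
  by rewrite ltrDl.
exists M; rewrite /marginal_edf; split.
  rewrite big_nat big1 ?mulr0// => i /YM; rewrite ltr_norml => /andP[h _].
  by rewrite leNgt h.
rewrite big_nat (eq_bigr (fun=> 1)).
  rewrite -big_nat sumr_const_nat subSS subn0 mulVf//.
  by rewrite pnatr_eq0 -lt0n.
by move=> i /YM; rewrite ltr_norml => /andP[_ h]; rewrite ltW.
Qed.

(** Holds for both clauses of [geninv]: below the supremum of the zero set the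
    function vanishes, and below the infimum of {H >= t} it is less than [t]. *)
Lemma marginal_edf_below_geninv (Y : int ->
    'rV[R]_d) (n : nat) p (t y : R) : (0 < n)%N ->
  0 <= t -> y < geninv (marginal_edf Y n p) t -> marginal_edf Y n p y <= t.
Proof.
move=> n0 t0; have [M [ML MR]] := marginal_edf_bounds Y p n0.
have mono a b : a <= b -> marginal_edf Y n p a <= marginal_edf Y n p b.
  by move=> ab; apply: marginal_edf_le => i /le_trans; apply.
rewrite /geninv; case: eqP => [->|/eqP tn0] yg.
  have [z /= z0 yz] : exists2 z, marginal_edf Y n p z = 0 & y < z.
    by apply: sup_gt yg; exists (- M).
  by rewrite -z0; apply: mono; exact: ltW.
rewrite leNgt; apply/negP => ty; have : inf [set x | t <= marginal_edf Y n p x] <= y.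
  apply: ge_inf; last exact: ltW.
  exists (- M) => z /= tz; rewrite leNgt; apply/negP => /ltW/mono.
  by rewrite ML => /(le_trans tz); rewrite leNgt lt_neqAle eq_sym tn0 t0.
by rewrite leNgt yg.
Qed.

Lemma marginal_edf_above_geninv (Y : int ->
    'rV[R]_d) (n : nat) p (t y : R) : (0 < n)%N ->
  0 <= t <= 1 -> geninv (marginal_edf Y n p) t < y -> t <= marginal_edf Y n p y.
Proof.
move=> n0 /andP[t0 t1]; have [M [ML MR]] := marginal_edf_bounds Y p n0.
rewrite /geninv; case: eqP => [->|/eqP tn0] yg; first exact: marginal_edf_ge0.
have [z /= tz zy] : exists2 z, t <= marginal_edf Y n p z & z < y.
  by apply: inf_lt yg; exists M; rewrite /= MR.
by apply: le_trans tz _; apply: marginal_edf_le => i /le_trans; apply; exact: ltW.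
Qed.

Variables (F : 'I_d -> R -> R) (Y : int -> 'rV[R]_d).
Hypothesis F_mono : forall p (a b : R), a <= b -> F p a <= F p b.
Hypothesis F_cont : forall p, continuous (F p).

Definition transform x : 'rV[R]_d := \row_p F p (x 0 p).
Let V i := transform (Y i).

Lemma transform_reflect p (a b : R) : F p a < F p b -> a < b.
Proof. by move=> h; rewrite ltNge; apply/negP => /(F_mono p); rewrite leNgt h. Qed.

(** A flat piece of some [F p] can make the inequality strict, so the lower bound
    in [joint_edf_close] comes from [transform_le_edf] instead. *)
Lemma edf_le_transform n x : edf Y n x <= edf V n (transform x).
Proof. by apply: edf_le => i h p; rewrite !mxE; exact: F_mono. Qed.

(** Strict inequality in the transformed scale can be pulled back through [F],
    whether or not [F] has flat pieces. *)
Lemma transform_le_edf n x (y : 'rV[R]_d) : (forall p, y 0 p < F p (x 0 p)) ->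
  edf V n y <= edf Y n x.
Proof.
move=> yx; apply: edf_le => i h p; apply/ltW/(@transform_reflect p).
by apply: le_lt_trans (yx p); have := h p; rewrite mxE.
Qed.

(** By continuity [F p] still exceeds [y] slightly to the left of the empirical
    quantile, so the sample points with transformed value at most [y] lie to the
    left of it. *)
Lemma marginal_edf_below_quantile n p (t y : R) : (0 < n)%N -> 0 <= t ->
  y < F p (geninv (marginal_edf Y n p) t) -> marginal_edf V n p y <= t.
Proof.
move=> n0 t0; set g := geninv _ _ => yg.
have [z zg yz] : exists2 z, z < g & y < F p z.
  have /nbhs_ballP[e /= e0 eP] : \forall z \near g, y < F p z.
    move: (@F_cont p g) => /cvgr_gt; exact.
  exists (g - e / 2); first by rewrite ltrBlDr ltrDl divr_gt0.
  apply: eP; rewrite /ball/= opprB addrC subrK gtr0_norm ?divr_gt0//.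
  by rewrite ltr_pdivrMr// ltr_pMr// ltr1n.
apply: le_trans (marginal_edf_below_geninv n0 t0 zg).
by apply: marginal_edf_le => i; rewrite mxE => h;
    apply/ltW/(@transform_reflect p)/(le_lt_trans h).
Qed.

Lemma marginal_edf_above_quantile n p (t y : R) : (0 < n)%N -> 0 <= t <= 1 ->
  F p (geninv (marginal_edf Y n p) t) < y -> t <= marginal_edf V n p y.
Proof.
move=> n0 t0; set g := geninv _ _ => yg.
have [z zg yz] : exists2 z, g < z & F p z < y.
  have /nbhs_ballP[e /= e0 eP] : \forall z \near g, F p z < y.
    move: (@F_cont p g) => /cvgr_lt; exact.
  exists (g + e / 2); first by rewrite ltrDl divr_gt0.
  apply: eP; rewrite /ball/= opprD addNKr normrN gtr0_norm ?divr_gt0//.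
  by rewrite ltr_pdivrMr// ltr_pMr// ltr1n.
apply: le_trans (marginal_edf_above_geninv n0 t0 zg) _.
by apply: marginal_edf_le => i h; rewrite mxE; apply: le_trans (ltW yz); exact: F_mono.
Qed.

End order_statistics.

(** * Pathwise bounds for empirical quantiles *)

Section delta_method.
Context (R : realType) (d : nat).
Implicit Types (u v w x : 'rV[R]_d) (p q : 'I_d).

(** [proj_ones u p] only depends on [u 0 p]; this is the corresponding curve in
    the cube. *)
Definition ones_but p (t : R) : 'rV[R]_d := \row_q (if q == p then t else 1).

Lemma proj_ones_but u p : proj_ones u p = ones_but p (u 0 p).
Proof. by []. Qed.

Lemma proj_ones_ones_but p t : proj_ones (ones_but p t) p = ones_but p t.
Proof. by apply/rowP => q; rewrite !mxE eqxx. Qed.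

Lemma cube_ones_but p t : 0 <= t <= 1 -> cube (ones_but p t).
Proof. by move=> t01 q; rewrite mxE; case: ifP => //; rewrite ler01 lexx. Qed.

Lemma ones_but_dist p (t t' r : R) : `|t - t'| < r ->
    `|ones_but p t - ones_but p t'| < r.
Proof.
move=> tr; have r0 : 0 < r by apply: le_lt_trans tr.
by apply: rV_norm_lt => // q; rewrite !mxE; case: ifP => // _; rewrite subrr normr0.
Qed.

Lemma D0_uniform_continuous (b : 'rV[R]_d -> R) : D0 b ->
  forall e : R, 0 < e -> exists2 r : R, 0 < r &
    forall u v, cube u -> cube v -> `|u - v| < r -> `|b u - b v| < e.
Proof.
move=> [cb _ _]; apply: compact_uniform_continuous cb => //.
exact: (@compact_box R d (fun=> 0) (fun=> 1)).
Qed.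

Lemma D0_ones_but0 (b : 'rV[R]_d -> R) p : D0 b -> b (ones_but p 0) = 0.
Proof.
move=> [_ _ b0]; apply: b0; first by apply: cube_ones_but; rewrite lexx ler01.
by exists p; rewrite mxE eqxx.
Qed.

Lemma D0_ones_but1 (b : 'rV[R]_d -> R) p : D0 b -> b (ones_but p 1) = 0.
Proof.
by move=> [_ <- _]; congr b; apply/rowP => q; rewrite !mxE if_same.
Qed.

Variable C : 'rV[R]_d -> R.
Hypothesis copC : is_copula C.

Lemma copula_ones_but p t : 0 <= t <= 1 -> C (ones_but p t) = t.
Proof.
move=> t01; rewrite -proj_ones_ones_but (copula_proj_ones copC);
    last exact: cube_ones_but.
by rewrite mxE eqxx.
Qed.

Variables (F : 'I_d -> R -> R).
Hypothesis F_mono : forall p (a b : R), a <= b -> F p a <= F p b.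
Hypothesis F_cont : forall p, continuous (F p).
Hypothesis F01 : forall p t, 0 <= F p t <= 1.

Lemma cube_transform x : cube (transform F x).
Proof. by move=> p; rewrite mxE. Qed.

Lemma le_left_limit (g : R -> R) (a c : R) :
  (forall e : R, 0 < e -> exists2 r : R, 0 < r &
     forall y, 0 <= y <= 1 -> `|y - a| < r -> `|g y - g a| < e) ->
  0 < a <= 1 -> (forall y, 0 <= y <= 1 -> y < a -> g y <= c) -> g a <= c.
Proof.
move=> gc /andP[a0 a1] gle; apply/ler_addgt0Pr => e e0.
have [r r0 rP] := gc _ e0.
pose y := Num.max 0 (a - r / 2).
have y0 : 0 <= y by rewrite le_max lexx.
have ya : y < a by rewrite gt_max a0/= ltrBlDr ltrDl divr_gt0.
have ry : a - r / 2 <= y by rewrite le_max lexx orbT.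
clearbody y.
have y01 : 0 <= y <= 1 by apply/andP; split; lra.
have yr : `|y - a| < r by rewrite ltr_norml; apply/andP; split; lra.
have := rP _ y01 yr; rewrite ltr_norml => /andP[h _].
have := gle _ y01 ya; lra.
Qed.

Lemma ge_right_limit (g : R -> R) (a c : R) :
  (forall e : R, 0 < e -> exists2 r : R, 0 < r &
     forall y, 0 <= y <= 1 -> `|y - a| < r -> `|g y - g a| < e) ->
  0 <= a < 1 -> (forall y, 0 <= y <= 1 -> a < y -> c <= g y) -> c <= g a.
Proof.
move=> gc /andP[a0 a1] gle; apply/ler_addgt0Pr => e e0.
have [r r0 rP] := gc _ e0.
pose y := Num.min 1 (a + r / 2).
have y1 : y <= 1 by rewrite ge_min lexx.
have ya : a < y by rewrite lt_min a1/= ltrDl divr_gt0.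
have ry : y <= a + r / 2 by rewrite ge_min lexx orbT.
clearbody y.
have y01 : 0 <= y <= 1 by apply/andP; split; lra.
have yr : `|y - a| < r by rewrite ltr_norml; apply/andP; split; lra.
have := rP _ y01 yr; rewrite ltr_norml => /andP[_ h].
have := gle _ y01 ya; lra.
Qed.

Section fixed_sample.
Variables (b : 'rV[R]_d -> R) (Y : int -> 'rV[R]_d) (n : nat) (s r : R).
Hypothesis bD0 : D0 b.
Hypothesis n_gt0 : (0 < n)%N.
Hypothesis s_gt0 : 0 < s.
Let V i := transform F (Y i).
Hypothesis close : forall u, cube u -> `|b u - s * (edf V n u - C u)| <= r.

(** [edf Y n x] lies between the values of [edf V n] at [v] and at points
    strictly below [v].  The latter converge to [v] along the ray through the
    origin, unless [v] has a zero coordinate, where [b] and [C] vanish. *)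
Lemma joint_edf_close x (v := transform F x) :
  `|b v - s * (edf Y n x - C v)| <= r.
Proof.
have cv : cube v := cube_transform x.
have r0 : 0 <= r by apply: le_trans (close cv).
have /ler_normlP[lo _] := close cv.
have up : s * edf Y n x <= s * edf V n v.
  by rewrite ler_pM2l//; exact: edf_le_transform.
apply/ler_normlP; split; first lra.
have [[p vp0]|v_pos] := pselect (exists p, v 0 p = 0).
  have [_ _ b0] := bD0.
  rewrite (copula_eq0 copC cv vp0) b0//; last by exists p.
  by rewrite sub0r subr0; apply: le_trans r0;
      rewrite oppr_le0 mulr_ge0 ?(ltW s_gt0)// edf_ge0.
apply/ler_addgt0Pr => e e0.
have e2 : 0 < e / 2 by rewrite divr_gt0.
have [rho rho0 rhoP] := D0_uniform_continuous bD0 e2.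
have sd : 0 < s * d.+1%:R by rewrite mulr_gt0.
(* The three bounds keep [y] in the cube, [b y] close to [b v], and
   [s * (C v - C y)] small. *)
pose th := Num.min (1/2) (Num.min (rho / 2) (e / 2 / (s * d.+1%:R))).
have th0 : 0 < th by rewrite !lt_min !divr_gt0// mulr_gt0.
have th1 : th <= 1 / 2 by rewrite ge_min lexx.
have thrho : th <= rho / 2 by rewrite !ge_min lexx !orbT.
have the : s * d.+1%:R * th <= e / 2.
  by rewrite mulrC -ler_pdivlMr// !ge_min lexx !orbT.
clearbody th.
pose y := (1 - th) *: v.
have v0 p : 0 < v 0 p.
  have /andP[v0 _] := cv p; rewrite lt_neqAle v0 andbT eq_sym.
  by apply/eqP => vp; apply: v_pos; exists p.
have yE p : y 0 p = (1 - th) * v 0 p by rewrite mxE.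
have vy p : v 0 p - y 0 p = th * v 0 p by rewrite yE; ring.
have thv p : 0 < th * v 0 p <= th.
  have /andP[_ v1] := cv p.
  by apply/andP; split; [exact: mulr_gt0|exact: (ler_piMr (ltW th0) v1)].
have cy : cube y.
  move=> p; have := thv p; have := vy p; have /andP[? ?] := cv p; move=> E /andP[? ?].
  apply/andP; split; last lra.
  by rewrite yE mulr_ge0//; lra.
have Gy : s * edf V n y <= s * edf Y n x.
  rewrite ler_pM2l//; apply: transform_le_edf => // p.
  have := thv p; have := vy p; rewrite /v mxE => E /andP[? ?]; lra.
have bvy : b v - b y < e / 2.
  apply: le_lt_trans (ler_norm _) _; apply: rhoP => //.
  apply: rV_norm_lt => // p; rewrite !mxE.
  rewrite (_ : _ - _ = v 0 p - y 0 p); last by rewrite !mxE.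
  by rewrite vy gtr0_norm; have /andP[? ?] := thv p; lra.
have Cvy : s * (C v - C y) <= e / 2.
  apply: le_trans the; rewrite -mulrA ler_pM2l//.
  apply: le_trans (ler_norm _) _; apply: le_trans (copula_lipschitz copC cy cv) _.
  apply: (@le_trans _ _ (\sum_(p < d) th)).
    by apply: ler_sum => p _; rewrite vy gtr0_norm; have /andP[? ?] := thv p.
  by rewrite sumr_const card_ord -[X in X <= _]mulr_natl ler_pM2r// ler_nat.
have /ler_normlP[_ hy] := close cy.
lra.
Qed.

Lemma marginal_close p (t : R) : 0 <= t <= 1 ->
  `|b (ones_but p t) - s * (marginal_edf V n p t - t)| <= r.
Proof.
move=> t01; have := close (cube_ones_but p t01); rewrite copula_ones_but//.
by rewrite edf_ones_but// => i q; rewrite mxE; have /andP[] := F01 q (Y i 0 q).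
Qed.

(** With g y = b (ones_but p y) + s y, closeness on the [p]-th margin gives
    g y <= s t + r for y < xi and g y >= s t - r for y > xi, and g is continuous.
    At xi = 0 and xi = 1 one of the two sides is empty, and there [b] vanishes. *)
Lemma quantile_close p (t : R) (xi := F p (geninv (marginal_edf Y n p) t)) :
  0 <= t <= 1 -> `|s * (xi - t) + b (ones_but p xi)| <= r.
Proof.
move=> /andP[t0 t1].
have xi01 : 0 <= xi <= 1 by exact: F01.
have r0 : 0 <= r by apply: le_trans (close (cube_ones_but p xi01)).
pose g y := b (ones_but p y) + s * y.
have gc e : 0 < e -> exists2 r : R, 0 < r &
    forall y, 0 <= y <= 1 -> `|y - xi| < r -> `|g y - g xi| < e.
  move=> e0; have e2 : 0 < e / 2 by rewrite divr_gt0.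
  have [rho rho0 rhoP] := D0_uniform_continuous bD0 e2.
  exists (Num.min rho (e / 2 / s)); first by rewrite lt_min rho0 divr_gt0.
  move=> y y01; rewrite lt_min => /andP[y1 y2].
  have h1 := rhoP _ _ (cube_ones_but p y01) (cube_ones_but p xi01) (ones_but_dist p y1).
  have h2 : `|s * (y - xi)| < e / 2.
    by rewrite normrM gtr0_norm// mulrC -ltr_pdivlMr.
  rewrite (_ : _ - _ = (b (ones_but p y) - b (ones_but p xi)) + s * (y - xi));
      last by rewrite /g; ring.
  by apply: le_lt_trans (ler_normD _ _) _; lra.
rewrite ler_norml; apply/andP; split.
- suff : s * t - r <= g xi by rewrite /g; lra.
  have [xi1|xi1] := ltP xi 1; last first.
    have -> : xi = 1 by apply/eqP; rewrite eq_le xi1 andbT; have /andP[] := xi01.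
    rewrite /g D0_ones_but1//; have : s * t <= s * 1 by rewrite ler_pM2l. lra.
  apply: (ge_right_limit gc); first by rewrite xi1 andbT; have /andP[] := xi01.
  move=> y y01 xiy; have /ler_normlP[h _] := marginal_close p y01.
  have : s * t <= s * marginal_edf V n p y.
    by rewrite ler_pM2l//; apply: marginal_edf_above_quantile => //; rewrite t0.
  rewrite /g; lra.
- suff : g xi <= s * t + r by rewrite /g; lra.
  have [xi0|xi0] := ltP 0 xi; last first.
    have -> : xi = 0 by apply/eqP; rewrite eq_le xi0; have /andP[] := xi01.
    by rewrite /g D0_ones_but0// mulr0 add0r addr_ge0// mulr_ge0// ltW.
  apply: (le_left_limit gc); first by rewrite xi0; have /andP[] := xi01.
  move=> y y01 xiy; have /ler_normlP[_ h] := marginal_close p y01.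
  have : s * marginal_edf V n p y <= s * t.
    by rewrite ler_pM2l//; exact: marginal_edf_below_quantile.
  rewrite /g; lra.
Qed.

End fixed_sample.
End delta_method.

(** * The limit map and the delta method *)

Section limit_map.
Context (R : realType) (d : nat).
Implicit Types (u v w x : 'rV[R]_d) (p q : 'I_d).
Variable C : 'rV[R]_d -> R.
Hypothesis copC : is_copula C.
Hypothesis C_derivable : forall p u,
  cube u -> 0 < u 0 p < 1 -> derivable C u (unit_vec R p).

Definition limit_map (b : {uniform` (@cube R d) -> R}) : {uniform` (@cube R d) -> R} :=
  limit_field C id b.

(** The partial derivatives are bounded by 1, so the limit map is Lipschitz on
    l^oo even where they are discontinuous. *)
Lemma limit_map_dist (b c : {uniform` (@cube R d) -> R}) (e : R) :
  (forall u, cube u -> `|b u - c u| <= e) ->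
  forall u, cube u -> `|limit_map b u - limit_map c u| <= d.+1%:R * e.
Proof.
move=> bc u cu.
have -> : limit_map b u - limit_map c u =
    (b u - c u) - \sum_(p < d) partial C p u * (b (proj_ones u p) - c (proj_ones u p)).
  under eq_bigr do rewrite mulrBr.
  rewrite sumrB /limit_map /limit_field/=; ring.
apply: le_trans (ler_normB _ _) _; rewrite -natr1 mulrDl mul1r addrC lerD//;
    last exact: bc.
apply: le_trans (ler_norm_sum _ _ _) _.
apply: (@le_trans _ _ (\sum_(p < d) e)).
  apply: ler_sum => p _; rewrite normrM.
  apply: le_trans (ler_piMl _ (partial_norm_le1 copC C_derivable p cu)) _ => //.
  by apply: bc; exact: cube_proj_ones.
by rewrite sumr_const card_ord mulr_natl.
Qed.

Lemma limit_map_continuous : continuous limit_map.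
Proof.
apply: lipschitz_uniform_continuous; exists d.+1%:R => // f g e e0 fg u cu.
by apply: limit_map_dist => // v cv; exact/ltW/fg.
Qed.

Lemma limit_map_linf b : linf (@cube R d) b -> linf (@cube R d) (limit_map b).
Proof.
move=> [M bM]; exists (d.+1%:R * M) => u cu.
have := @limit_map_dist b (fun=> 0) M _ u cu.
have -> : limit_map (fun=> 0) u = 0.
  by rewrite /limit_map /limit_field/= big1 ?subr0// => p _; rewrite mulr0.
by rewrite subr0; apply => v cv; rewrite subr0; exact: bM.
Qed.

(** Needed so that tightness can be sharpened to a compact subset of [D0]. *)
Lemma D0_closed : closed (@D0 R d : set {uniform` (@cube R d) -> R}).
Proof.
move=> b clb.
have approx (e : R) : 0 < e -> exists2 c, D0 c & forall u, cube u -> `|b u - c u| < e.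
  move=> e0; have [|c [D0c bc]] := clb [set c : {uniform` (@cube R d) ->
      R} | forall u, cube u -> `|b u - c u| < e].
    by apply/uniform_nbhsP; exists e.
  by exists c.
have zero u : cube u -> (forall c, D0 c -> c u = 0) -> b u = 0.
  move=> cu c0; apply/eqP; rewrite -normr_le0; apply/ler_addgt0Pr => e e0.
  have [c Dc bc] := approx _ e0; rewrite add0r.
  by have := bc u cu; rewrite (c0 _ Dc) subr0 => /ltW.
split.
- apply/subspace_continuousP => u cu; apply/cvgrPdist_lt => e e0.
  have e3 : 0 < e / 3 by rewrite divr_gt0.
  have [c Dc bc] := approx _ e3.
  have [/subspace_continuousP/(_ u cu)/cvgrPdist_lt/(_ _ e3) + _ _] := Dc.
  rewrite !near_withinE; apply: filterS => v h cv.
  have := bc u cu; have := bc v cv; have := h cv.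
  rewrite (_ : b u - b v = (b u - c u) + (c u - c v) - (b v - c v)); last by ring.
  move=> h1 h2 h3; apply: le_lt_trans (ler_normB _ _) _.
  rewrite (_ : e = e / 3 + e / 3 + e / 3); last by field.
  by apply: ltrD => //; apply: le_lt_trans (ler_normD _ _) _; exact: ltrD.
- apply: zero; last by move=> c [].
  by move=> p; rewrite mxE ler01 lexx.
- by move=> x cx xp; apply: zero => // c [_ _]; exact.
Qed.

Hypothesis partial_continuous : forall p,
  {within [set u | cube u /\ 0 < u 0 p < 1], continuous (partial C p)}.
Variables (F : 'I_d -> R -> R).
Hypothesis F_mono : forall p (a b : R), a <= b -> F p a <= F p b.
Hypothesis F_cont : forall p, continuous (F p).
Hypothesis F01 : forall p t, 0 <= F p t <= 1.

(** Decompose s (C_n(u) - C(u)) as s (F_n(x) - C(v)) + s (C(v) - C(u)) with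
    x = F_n^-(u) and v = F(x): the first term is close to b v by
    [joint_edf_close], hence to b u, and the second is expanded by
    [copula_expansion], whose hypothesis on v - u comes from [quantile_close]. *)
Lemma empirical_copula_delta (b : 'rV[R]_d -> R) (e : R) :
  linf (@cube R d) b -> D0 b -> 0 < e -> exists2 r : R, 0 < r &
  \forall n \near \oo, forall Y : int -> 'rV[R]_d,
    (forall u, cube u ->
       `|b u - Num.sqrt n%:R * (edf (fun i => transform F (Y i)) n u - C u)| < r) ->
    forall u, cube u ->
      `|limit_map b u - Num.sqrt n%:R * (empirical_copula Y n u - C u)| < e.
Proof.
move=> [M0 bM0] D0b e0.
pose M := `|M0| + 1.
have M_gt0 : 0 < M by rewrite /M; have := normr_ge0 M0; lra.
have bM u : cube u -> `|b u| <= M.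
  by move=> /bM0; have := ler_norm M0; rewrite /M; lra.
clearbody M.
have e2 : 0 < e / 2 by rewrite divr_gt0.
pose be p t := b (ones_but p t).
have beM p t : 0 <= t <= 1 -> `|be p t| <= M by move=> /(cube_ones_but p); exact: bM.
have be0 p (e' : R) : 0 < e' -> exists2 k : R, 0 < k &
     forall t, 0 <= t <= 1 -> t < k \/ 1 - k < t -> `|be p t| < e'.
  move=> e'0; have [k k0 kP] := D0_uniform_continuous D0b e'0; exists k => //.
  move=> t t01 [tk|tk].
    rewrite -[be p t]subr0 -(D0_ones_but0 p D0b); apply: kP.
    - exact: cube_ones_but.
    - by apply: cube_ones_but; rewrite lexx ler01.
    - by apply: ones_but_dist; rewrite subr0 ger0_norm//; have /andP[] := t01.
  rewrite -[be p t]subr0 -(D0_ones_but1 p D0b); apply: kP.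
  - exact: cube_ones_but.
  - by apply: cube_ones_but; rewrite lexx ler01.
  - apply: ones_but_dist; rewrite distrC ger0_norm ?subr_ge0;
      last by have /andP[] := t01.
    by lra.
have [r1 r10 r1P] := copula_expansion copC C_derivable partial_continuous e2
    M_gt0 beM be0.
have m0 : 0 < Num.min (r1 / 2) (e / 8) by rewrite lt_min !divr_gt0.
have [r2 r20 r2P] := D0_uniform_continuous D0b m0.
set m := Num.min _ _ in m0 r2P.
have [m1 m2] : m <= r1 / 2 /\ m <= e / 8 by rewrite !ge_min !lexx orbT.
clearbody m.
exists m => //.
(* The step [v - u] is at most (M + m) / sqrt n. *)
have big_n : \forall n \near \oo, (0 < n)%N /\ (M + m) / Num.min r1 r2 <
    Num.sqrt n%:R :> R.
  near=> n; split; first by near: n; exact: nbhs_infty_gt.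
  have q0 : 0 <= (M + m) / Num.min r1 r2.
    by apply: divr_ge0; [apply: addr_ge0; exact: ltW|rewrite le_min !ltW].
  set q := _ / _ in q0 *.
  rewrite -(ger0_norm q0) -sqrtr_sqr ltr_sqrt; last first.
    by rewrite ltr0n; near: n; exact: nbhs_infty_gt.
  by near: n; exact: nbhs_infty_gtr.
apply: filterS big_n => n [n0 nq] Y close u cu.
set s := Num.sqrt n%:R in nq close *.
have s0 : 0 < s by rewrite sqrtr_gt0 ltr0n.
have closeW v : cube v -> `|b v - s * (edf (fun i => transform F (Y i)) n v - C
    v)| <= m.
  by move=> /close/ltW.
pose x : 'rV[R]_d := \row_p geninv (marginal_edf Y n p) (u 0 p).
pose v := transform F x.
have cv : cube v := cube_transform F01 x.
have vq p : `|s * (v 0 p - u 0 p) + be p (v 0 p)| <= m.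
  have := @quantile_close _ _ _ copC _ F_mono F_cont F01 b Y n s m D0b n0 s0
      closeW p (u 0 p) (cu p).
  by rewrite /v !mxE.
have vu p : `|v 0 p - u 0 p| < Num.min r1 r2.
  have r120 : 0 < Num.min r1 r2 by rewrite lt_min r10.
  rewrite -(ltr_pM2l s0) -[X in X * _ < _](gtr0_norm s0) -normrM.
  move: nq; rewrite ltr_pdivrMr// => nq.
  apply: le_lt_trans nq.
  rewrite (_ : s * _ = (s * (v 0 p - u 0 p) + be p (v 0 p)) - be p (v 0 p));
      last by ring.
  apply: le_trans (ler_normB _ _) _.
  have := vq p; have := beM p _ (cv p); lra.
have vr1 p : `|v 0 p - u 0 p| <= r1 by have := vu p; rewrite lt_min => /andP[/ltW].
have vr2 p : `|v 0 p - u 0 p| < r2 by have := vu p; rewrite lt_min => /andP[].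
have vqu p : `|s * (v 0 p - u 0 p) + be p (u 0 p)| <= r1.
  have h : `|be p (u 0 p) - be p (v 0 p)| < m.
    apply: r2P; [exact: cube_ones_but|exact: cube_ones_but|].
    by apply: ones_but_dist; rewrite distrC.
  rewrite (_ : _ + _ = (s * (v 0 p - u 0 p) + be p (v 0 p)) + (be p (u 0 p) -
      be p (v 0 p))); last by ring.
  apply: le_trans (ler_normD _ _) _; have := vq p; lra.
have h1 := r1P s u v s0 cu cv vr1 vqu.
have h2 := @joint_edf_close _ _ _ copC _ F_mono F01 b Y n s m D0b s0 closeW x.
have h3 : `|b u - b v| < m.
  by apply: r2P => //; apply: rV_norm_lt => // p; rewrite !mxE distrC;
      have := vr2 p; rewrite !mxE.
have -> : limit_map b u - s * (empirical_copula Y n u - C u) =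
   (b u - b v) + (b v - s * (edf Y n x - C v)) -
   (s * (C v - C u) + \sum_(p < d) partial C p u * be p (u 0 p)).
  rewrite /limit_map /limit_field /empirical_copula -/x/= /be.
  under eq_bigr do rewrite proj_ones_but.
  by ring.
apply: le_lt_trans (ler_normB _ _) _.
apply: le_lt_trans (lerD (ler_normD _ _) (lexx _)) _.
apply: (@lt_le_trans _ _ (m + m + e / 2)); last lra.
by apply: ltr_leD h1; exact: ltr_leD h3 h2.
Unshelve. all: by end_near. Qed.

End limit_map.

(** A linear combination of values of the limit field at the [t j] is one of
    values of [B] at the points [t j] and their projections, indexed here by
    the pairs of [j] and an optional coordinate. *)
Lemma gaussian_limit_field (R : realType) (d : nat) (C : 'rV[R]_d -> R)
  (dB : measure_display) (OmegaB : measurableType dB)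
  (PB : probability OmegaB R) (B : OmegaB -> 'rV[R]_d -> R) :
  gaussian_field (@cube R d) PB B ->
  gaussian_field (@cube R d) PB (limit_field C B).
Proof.
move=> gB k t a ct.
pose I := ('I_k * option 'I_d)%type.
pose T (i : I) := if i.2 is Some p then proj_ones (t i.1) p else t i.1.
pose c (i : I) := if i.2 is Some p then - (a i.1 * partial C p (t i.1)) else a i.1.
have cT i : cube (T i).
  by case: i => j [p|]; [exact/cube_proj_ones/ct|exact: ct].
have -> : (fun w => \sum_(j < k) a j * limit_field C B w (t j)) =
    (fun w => \sum_(m < #|{: I}|) c (enum_val m) * B w (T (enum_val m))).
  apply/funext => w; rewrite -(big_enum_val (fun i : I => c i * B w (T i))) /=.
  rewrite -(pair_bigA _ (fun j o => c (j, o) * B w (T (j, o))))/=.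
  apply: eq_bigr => j _.
  rewrite (bigD1 None)//= (reindex_omap Some id)/=; last by case.
  rewrite /limit_field mulrBr mulr_sumr -sumrN; congr (_ + _).
  by apply: eq_big => [p|p _]; rewrite ?eqxx// mulNr mulrA.
exact: (gB _ (fun m => T (enum_val m)) (fun m => c (enum_val m)) (fun m => cT _)).
Qed.

(** * Weak convergence of the empirical copula process *)

Section marginal_df_facts.
Context (R : realType) (d : nat) (dO : measure_display)
  (Omega : measurableType dO) (P : probability Omega R)
  (Y : {RV P >-> d.-tuple R}).

Lemma measurable_marginal_le p (t : R) : measurable [set w | tnth (Y w) p <= t].
Proof.
rewrite -[X in measurable X]setTI.
exact: (measurable_funPT Y measurableT _ (measurable_le_tnth p t)).
Qed.

Lemma marginal_df_ge0_le1 p t : 0 <= marginal_df Y p t <= 1.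
Proof.
have mS := measurable_marginal_le p t.
rewrite /marginal_df fine_ge0 ?measure_ge0//= -lee_fin fineK ?fin_num_measure//.
exact: probability_le1.
Qed.

Lemma marginal_df_mono p (s t : R) : s <= t -> marginal_df Y p s <= marginal_df Y p t.
Proof.
move=> st; have mS := measurable_marginal_le p.
rewrite -lee_fin !fineK ?fin_num_measure//.
by apply: le_measure; rewrite ?inE// => w /= /le_trans; apply.
Qed.

End marginal_df_facts.

Theorem corollary2p5 (R : realType) (d : nat) (hd : (2 <= d)%N)
    (dO : measure_display) (Omega : measurableType dO)
    (P : probability Omega R)
    (X : int -> {RV P >-> d.-tuple R})
    (X_stationary : strictly_stationary X)
    (F_continuous : forall p : 'I_d, continuous (marginal_df (X 0) p))
    (C : 'rV[R]_d -> R) (C_copula : copula_of C (X 0))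
    (dB : measure_display) (OmegaB : measurableType dB)
    (PB : probability OmegaB R) (B : OmegaB -> 'rV[R]_d -> R)
    (B_tight : tight (@cube R d) PB B)
    (B_centered : centered (@cube R d) PB B)
    (B_gaussian : gaussian_field (@cube R d) PB B)
    (B_D0 : {ae PB, forall w, D0 (B w)})
    (alpha_cvg : weak_cvg (@cube R d) P (empirical_process X C) PB B)
    (C_derivable : forall (p : 'I_d) (u : 'rV[R]_d),
      cube u -> 0 < u 0 p < 1 -> derivable C u (unit_vec R p))
    (partial_continuous : forall p : 'I_d,
      {within [set u | cube u /\ 0 < u 0 p < 1], continuous (partial C p)}) :
  gaussian_field (@cube R d) PB (limit_field C B) /\
  weak_cvg (@cube R d) P (empirical_copula_process X C) PB (limit_field C B).

Proof.
have [copC _] := C_copula.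
split; first exact: gaussian_limit_field.
pose F p := marginal_df (X 0) p.
have Fmono p (a b : R) : a <= b -> F p a <= F p b by exact: marginal_df_mono.
have F01 p t : 0 <= F p t <= 1 by exact: marginal_df_ge0_le1.
have UE w : uniformized_obs X w = fun i => transform F (obs X w i).
  by apply/funext => i; apply/rowP => p; rewrite !mxE.
apply: (extended_continuous_mapping (limit_map_continuous copC C_derivable)
  (limit_map_linf copC C_derivable) alpha_cvg B_tight (@D0_closed R d) B_D0).
- move=> n w; exists (Num.sqrt n%:R * 2) => u cu.
  rewrite normrM ger0_norm ?sqrtr_ge0// ler_wpM2l ?sqrtr_ge0//.
  have /andP[C0 C1] := copula_ge0_le1 copC cu.
  rewrite /empirical_copula; set x := (X in edf _ _ X).
  have := edf_ge0 (obs X w) n x; have := edf_le1 (obs X w) n x => G1 G0.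
  by rewrite ler_norml; apply/andP; split; lra.
- move=> b b_lin b_D0 e e0.
  have [r r0 rP] := empirical_copula_delta copC C_derivable partial_continuous
    Fmono F_continuous F01 b_lin b_D0 e0.
  exists r => //; apply: filterS rP => n rP w bw; apply: rP => u cu.
  by have := bw u cu; rewrite /empirical_process UE.
Qed.
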